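(* There is a polynomial-time algorithm which, given a tournament $T=(V,A)$ with non-negative (rational) vertex weights $w:V\to\mathbb{Q}_{\ge 0}$, outputs a feedback vertex set of $T$ whose weight is at most $\frac{7}{3}$ times the minimum weight of a feedback vertex set of $T$.
   Context: A tournament is an orientation of a complete graph. A feedback vertex set (FVS) of a tournament $T=(V,A)$ is a set $S\subseteq V$ such that $T[V\setminus S]$ contains no directed cycle. The weight of a set $S$ is $w(S)=\sum_{v\in S}w(v)$. *)

(* Defs.v *)
From HB Require Import structures.
From mathcomp Require Import all_boot all_order all_algebra.

Set Implicit Arguments.
Unset Strict Implicit.
Unset Printing Implicit Defensive.

Import Order.TTheory GRing.Theory Num.Theory.

(** The machine model is the WHILE language over binary trees with its
    unit-cost time measure (N. D. Jones, Computability and Complexity: From a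
    Programming Perspective, MIT Press, 1997). Trees are shared on assignment,
    so each elementary operation is a constant number of pointer operations,
    and WHILE programs and Turing machines simulate each other with polynomial
    overhead. *)

Inductive tree : Type :=
| Nil
| Cons of tree & tree.

Definition hd (d : tree) : tree := if d is Cons a _ then a else Nil.
Definition tl (d : tree) : tree := if d is Cons _ b then b else Nil.

Fixpoint tree_size (d : tree) : nat :=
  if d is Cons a b then (tree_size a + tree_size b).+1 else 1.

Definition store : Type := nat -> tree.

Definition upd (s : store) (x : nat) (d : tree) : store :=
  fun y => if y == x then d else s y.

Inductive expr : Type :=
| EVar of nat
| EConst of tree
| ECons of expr & expr
| EHd of expr
| ETl of expr.

Fixpoint eval (s : store) (e : expr) : tree :=
  match e with
  | EVar x => s x
  | EConst d => d
  | ECons e1 e2 => Cons (eval s e1) (eval s e2)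
  | EHd e1 => hd (eval s e1)
  | ETl e1 => tl (eval s e1)
  end.

Fixpoint etime (e : expr) : nat :=
  match e with
  | EVar _ | EConst _ => 1
  | ECons e1 e2 => (etime e1 + etime e2).+1
  | EHd e1 | ETl e1 => (etime e1).+1
  end.

Inductive cmd : Type :=
| CAssign of nat & expr
| CSeq of cmd & cmd
| CIf of expr & cmd & cmd
| CWhile of expr & cmd.

(** [exec c s t s']: started in store [s], the command [c] halts after exactly
    [t] time units in store [s']. [Nil] plays the role of false in tests. *)
Inductive exec : cmd -> store -> nat -> store -> Prop :=
| ExecAssign s x e :
    exec (CAssign x e) s (etime e).+1 (upd s x (eval s e))
| ExecSeq c1 c2 s s1 s2 t1 t2 :
    exec c1 s t1 s1 -> exec c2 s1 t2 s2 ->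
    exec (CSeq c1 c2) s (t1 + t2) s2
| ExecIfTrue e c1 c2 s s' t :
    eval s e <> Nil -> exec c1 s t s' ->
    exec (CIf e c1 c2) s (etime e + t).+1 s'
| ExecIfFalse e c1 c2 s s' t :
    eval s e = Nil -> exec c2 s t s' ->
    exec (CIf e c1 c2) s (etime e + t).+1 s'
| ExecWhileTrue e c s s1 s2 t1 t2 :
    eval s e <> Nil -> exec c s t1 s1 -> exec (CWhile e c) s1 t2 s2 ->
    exec (CWhile e c) s (etime e + t1 + t2).+1 s2
| ExecWhileFalse e c s :
    eval s e = Nil ->
    exec (CWhile e c) s (etime e).+1 s.

Lemma exec_deterministic c s t1 s1 t2 s2 :
  exec c s t1 s1 -> exec c s t2 s2 -> t1 = t2 /\ s1 = s2.
Proof.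
move=> H; elim: H t2 s2 => {c s t1 s1}.
- by move=> s x e t2 s2 H; inversion H.
- move=> c1 c2 s s1 s2 t1 t2 _ IH1 _ IH2 t' s' H.
  inversion H as [|? ? ? ? ? ? ? H1 H2| | | |]; subst.
  by have [? ?] := IH1 _ _ H1; subst; have [-> ->] := IH2 _ _ H2.
- move=> e c1 c2 s s1 t ne _ IH t' s' H; inversion H; subst => //.
  by match goal with h : exec c1 _ _ _ |- _ => have [-> ->] := IH _ _ h end.
- move=> e c1 c2 s s1 t eq _ IH t' s' H; inversion H; subst => //.
  by match goal with h : exec c2 _ _ _ |- _ => have [-> ->] := IH _ _ h end.
- move=> e c s s1 s2 t1 t2 ne _ IH1 _ IH2 t' s' H.
  inversion H as [| | | |? ? ? ? ? ? ? _ H1 H2|]; subst => //.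
  by have [? ?] := IH1 _ _ H1; subst; have [-> ->] := IH2 _ _ H2.
- by move=> e c s eq t' s' H; inversion H; subst.
Qed.

(** Variable 0 holds the input at the start and the output at the end; all
    other variables start as [Nil]. *)
Definition runs (c : cmd) (input : tree) (t : nat) (output : tree) : Prop :=
  exists s : store, exec c (upd (fun=> Nil) 0 input) t s /\ s 0 = output.

Definition enc_bool (b : bool) : tree := if b then Cons Nil Nil else Nil.

Definition enc_seq (X : Type) (f : X -> tree) (s : seq X) : tree :=
  foldr (fun x d => Cons (f x) d) Nil s.

(** Binary digits, least significant first, without leading zeros;
    [up_log 2 n.+1] is the number of binary digits of [n]. *)
Definition nat_bits (n : nat) : seq bool :=
  [seq odd (n %/ 2 ^ i) | i <- iota 0 (up_log 2 n.+1)].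

Definition enc_nat (n : nat) : tree := enc_seq enc_bool (nat_bits n).

(** Injective on non-negative rationals only: the sign is not recorded. *)
Definition enc_rat (q : rat) : tree :=
  Cons (enc_nat `|numq q|%N) (enc_nat `|denq q|%N).

(** Adjacency matrix (row by row) together with the list of weights, both in
    the order [enum V]. *)
Definition enc_instance (V : finType) (A : rel V) (w : V -> rat) : tree :=
  Cons (enc_seq (fun x => enc_seq (fun y => enc_bool (A x y)) (enum V)) (enum V))
       (enc_seq (fun x => enc_rat (w x)) (enum V)).

(** Characteristic vector in the order [enum V]. *)
Definition enc_set (V : finType) (S : {set V}) : tree :=
  enc_seq (fun x => enc_bool (x \in S)) (enum V).

Definition tournament (V : finType) (A : rel V) : Prop :=
  irreflexive A /\ forall x y : V, x != y -> A x y (+) A y x.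

Definition directed_cycle (V : finType) (A : rel V) (c : seq V) : Prop :=
  c != [::] /\ ucycle A c.

Definition feedback_vertex_set (V : finType) (A : rel V) (S : {set V}) : Prop :=
  forall c : seq V, {subset c <= ~: S} -> ~ directed_cycle A c.

Definition weight (V : finType) (w : V -> rat) (S : {set V}) : rat :=
  (\sum_(v in S) w v)%R.

Definition min_fvs_weight (V : finType) (A : rel V) (w : V -> rat) (m : rat)
  : Prop :=
  (exists2 S : {set V}, feedback_vertex_set A S & weight w S = m) /\
  (forall S : {set V}, feedback_vertex_set A S -> (m <= weight w S)%R).

(* Main.v *)
(** For a vertex [v], let [B v] be the bipartite graph between the in- and the
    out-neighbours of [v] whose edges are the triangles through [v]. Seven
    vertices consisting of [v] and an induced matching of size three in [B v]
    cannot be hit by fewer than three vertices, so that a local ratio step on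
    them (subtract their minimum weight) costs a factor 7/3. One pass over all
    7-tuples leaves a set [U] of vertices of positive weight without such a
    pattern.

    On [U] the problem is solved exactly. Let [p 1 -> ... -> p m] be a maximum
    transitive subset of [U], let [L i] be the in-neighbours of [p i] dominating
    all later [p j], and [R i] the set of vertices of [U] dominated by [p i] and
    [L i]. The sets [R i] decrease with [i]; the absence of patterns makes [R i]
    the common out-neighbourhood of [p i] and at most two vertices of [L i].
    Hence a maximum transitive subset is found by dynamic programming over
    triples of vertices.

    The functions that WHILE programs compute in polynomial time on encoded
    data, with results of polynomial size, are closed under composition and
    under iteration along lists as long as the intermediate results stay small.
    The algorithm can therefore be an ordinary function on lists of bits and
    numbers; the weights are first brought to a common denominator. *)

Require Import Defs.
From HB Require Import structures.
From mathcomp Require Import all_boot all_order all_algebra.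
From mathcomp Require Import zify.

(* [Cons] must denote the tree constructor, not the one of [seq]. *)
Import Defs.

Set Implicit Arguments.
Unset Strict Implicit.
Unset Printing Implicit Defensive.

(** * Polynomial growth *)

Lemma leq_wexpn2r k : {homo expn^~ k : m n / m <= n}.
Proof. by case: k => // k m n; rewrite leq_exp2r. Qed.

Definition polygrowth (p : nat -> nat) : Prop :=
  {homo p : m n / m <= n} /\ exists a k, forall n, p n <= a * n.+1 ^ k.

Lemma polygrowth_id : polygrowth id.
Proof. by split=> //; exists 1, 1 => n; rewrite expn1 mul1n. Qed.

Lemma polygrowth_const a : polygrowth (fun=> a).
Proof. by split=> //; exists a, 0 => n; rewrite expn0 muln1. Qed.

Lemma polygrowth_add p q :
  polygrowth p -> polygrowth q -> polygrowth (fun n => p n + q n).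
Proof.
move=> [mono_p [a [k le_p]]] [mono_q [b [l le_q]]]; split=> [m n mn|].
  by rewrite leq_add ?mono_p ?mono_q.
exists (a + b), (k + l) => n; rewrite mulnDl leq_add //.
  by apply: leq_trans (le_p n) _; rewrite leq_mul // leq_pexp2l ?leq_addr.
by apply: leq_trans (le_q n) _; rewrite leq_mul // leq_pexp2l ?leq_addl.
Qed.

Lemma polygrowth_succ p : polygrowth p -> polygrowth (fun n => (p n).+1).
Proof. exact: (polygrowth_add (polygrowth_const 1)). Qed.

Lemma polygrowth_mul p q :
  polygrowth p -> polygrowth q -> polygrowth (fun n => p n * q n).
Proof.
move=> [mono_p [a [k le_p]]] [mono_q [b [l le_q]]]; split=> [m n mn|].
  by rewrite leq_mul ?mono_p ?mono_q.
by exists (a * b), (k + l) => n; rewrite expnD mulnACA leq_mul.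
Qed.

Lemma polygrowth_comp p q :
  polygrowth p -> polygrowth q -> polygrowth (fun n => q (p n)).
Proof.
move=> [mono_p [a [k le_p]]] [mono_q [b [l le_q]]]; split=> [m n mn|].
  by rewrite mono_q ?mono_p.
exists (b * a.+1 ^ l), (k * l) => n; apply: leq_trans (le_q _) _.
rewrite expnM -mulnA -expnMn leq_mul // leq_wexpn2r //.
by rewrite mulSn -add1n leq_add ?expn_gt0.
Qed.

Create HintDb growth discriminated.
#[local] Hint Resolve polygrowth_id polygrowth_const polygrowth_add
  polygrowth_succ polygrowth_mul : growth.

Lemma polygrowth_leq_monomial p : polygrowth p ->
  exists a k, forall n, 0 < n -> p n <= a * n ^ k + a.
Proof.
move=> [_ [a [k le_p]]]; exists (a * 2 ^ k), k => n n_gt0.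
apply: leq_trans (le_p n) (leq_trans _ (leq_addr _ _)).
rewrite -mulnA -expnMn leq_mul // leq_wexpn2r //; lia.
Qed.

(** * Programs that halt within a time bound *)

Definition halts (c : cmd) (s : store) (T : nat) (Q : store -> Prop) : Prop :=
  exists t s', [/\ exec c s t s', t <= T & Q s'].

Lemma halts_weaken c s T T' (Q Q' : store -> Prop) :
  T <= T' -> (forall s', Q s' -> Q' s') -> halts c s T Q -> halts c s T' Q'.
Proof.
move=> TT' QQ' [t [s' [cs tT Qs']]]; exists t, s'.
by split=> //; [exact: leq_trans TT' | exact: QQ'].
Qed.

Lemma halts_assign x e s (Q : store -> Prop) :
  Q (upd s x (eval s e)) -> halts (CAssign x e) s (etime e).+1 Q.
Proof. by move=> Qs; do 2!eexists; split; [exact: ExecAssign | | exact: Qs]. Qed.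

Lemma halts_seq c1 c2 s T1 T2 Q :
  halts c1 s T1 (fun s1 => halts c2 s1 T2 Q) -> halts (CSeq c1 c2) s (T1 + T2) Q.
Proof.
move=> [t1 [s1 [cs1 tT1 [t2 [s2 [cs2 tT2 Qs2]]]]]].
by exists (t1 + t2), s2; split=> //; [exact: ExecSeq cs2 | exact: leq_add].
Qed.

Lemma halts_if e c1 c2 s T Q :
  (eval s e <> Nil -> halts c1 s T Q) -> (eval s e = Nil -> halts c2 s T Q) ->
  halts (CIf e c1 c2) s (etime e + T).+1 Q.
Proof.
move=> h1 h2; case eE: (eval s e) => [|d1 d2].
  have [t [s' [cs tT Qs']]] := h2 eE; exists (etime e + t).+1, s'.
  by split=> //; [exact: ExecIfFalse | rewrite ltnS leq_add2l].
have ne : eval s e <> Nil by rewrite eE.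
have [t [s' [cs tT Qs']]] := h1 ne; exists (etime e + t).+1, s'.
by split=> //; [exact: ExecIfTrue | rewrite ltnS leq_add2l].
Qed.

Lemma halts_while_false e c s (Q : store -> Prop) :
  eval s e = Nil -> Q s -> halts (CWhile e c) s (etime e).+1 Q.
Proof. by move=> eE Qs; do 2!eexists; split; [exact: ExecWhileFalse | | exact: Qs]. Qed.

Lemma halts_while_true e c s T1 T2 Q : eval s e <> Nil ->
  halts c s T1 (fun s1 => halts (CWhile e c) s1 T2 Q) ->
  halts (CWhile e c) s (etime e + T1 + T2).+1 Q.
Proof.
move=> ne [t1 [s1 [cs1 tT1 [t2 [s2 [cs2 tT2 Qs2]]]]]].
exists (etime e + t1 + t2).+1, s2; split=> //; first exact: ExecWhileTrue cs2.
by rewrite ltnS leq_add ?leq_add2l.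
Qed.

Lemma upd_eq s x d : upd s x d x = d.
Proof. by rewrite /upd eqxx. Qed.

Lemma upd_neq s x d y : y != x -> upd s x d y = s y.
Proof. by rewrite /upd => /negbTE->. Qed.

(** * Polynomial-time functions on encoded data *)

HB.mixin Record isEncodable (X : Type) := { code : X -> tree }.

#[short(type="encType")]
HB.structure Definition Encodable := { X of isEncodable X }.

HB.instance Definition _ := isEncodable.Build bool enc_bool.
HB.instance Definition _ := isEncodable.Build nat enc_nat.
HB.instance Definition _ (X Y : encType) :=
  isEncodable.Build (X * Y)%type (fun z => Cons (code z.1) (code z.2)).
HB.instance Definition _ (X : encType) :=
  isEncodable.Build (seq X) (enc_seq (@code X)).

Definition code_size (X : encType) (x : X) : nat := tree_size (code x).

Lemma tree_size_gt0 d : 0 < tree_size d.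
Proof. by case: d. Qed.

Lemma code_size_gt0 (X : encType) (x : X) : 0 < code_size x.
Proof. exact: tree_size_gt0. Qed.

Lemma code_size_pair (X Y : encType) (x : X) (y : Y) :
  code_size (x, y) = (code_size x + code_size y).+1.
Proof. by []. Qed.

Lemma code_size_bool (b : bool) : code_size b <= 3.
Proof. by case: b. Qed.

Lemma code_size_nil (X : encType) : code_size ([::] : seq X) = 1.
Proof. by []. Qed.

Lemma code_size_cons (X : encType) (x : X) s :
  code_size (x :: s) = (code_size x + code_size s).+1.
Proof. by []. Qed.

Lemma code_size_cat (X : encType) (s t : seq X) :
  (code_size (s ++ t)).+1 = code_size s + code_size t.
Proof. by elim: s => //= x s IH; rewrite !code_size_cons -addnS IH addSn addnA. Qed.

Lemma code_size_rcons (X : encType) (s : seq X) x :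
  code_size (rcons s x) = (code_size s + code_size x).+1.
Proof.
by apply: succn_inj; rewrite -cats1 code_size_cat code_size_cons addn1 !addnS.
Qed.

Lemma leq_code_size_catl (X : encType) (s t : seq X) :
  code_size s <= code_size (s ++ t).
Proof. by rewrite -ltnS code_size_cat -addn1 leq_add2l code_size_gt0. Qed.

Lemma ltn_size_code_size (X : encType) (s : seq X) : size s < code_size s.
Proof. by elim: s => // x s IH; rewrite code_size_cons /=; lia. Qed.

(** [c] may overwrite the variables below [N] and must work whatever they
    contain initially; this makes programs composable without renaming. *)
Definition computes (X Y : encType) (c : cmd) (N : nat) (f : X -> Y)
    (T : nat -> nat) : Prop :=
  forall x s, s 0 = code x -> halts c s (T (code_size x))
    (fun s' => s' 0 = code (f x) /\ forall y, N <= y -> s' y = s y).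

Lemma computes_weaken (X Y : encType) c N N' (f : X -> Y) T :
  N <= N' -> computes c N f T -> computes c N' f T.
Proof.
move=> NN' cf x s s0; apply: halts_weaken (cf x s s0) => // s' [s'0 frame].
by split=> // y N'y; rewrite frame // (leq_trans NN').
Qed.

(* Sharing lets a program build trees of exponential size in linear time, so
   the size of the output has to be bounded separately. *)
Definition polytime (X Y : encType) (f : X -> Y) : Prop :=
  exists c N p, [/\ polygrowth p,
    forall x, code_size (f x) <= p (code_size x) & computes c N f p].
Arguments polytime : simpl never.

Lemma polytime_intro (X Y : encType) (f : X -> Y) c N p q :
  polygrowth p -> polygrowth q ->
  (forall x, code_size (f x) <= p (code_size x)) -> computes c N f q ->
  polytime f.
Proof.
move=> pp pq le_f cf; exists c, N, (fun n => p n + q n); split.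
- exact: polygrowth_add.
- by move=> x; rewrite (leq_trans (le_f x)) ?leq_addr.
- by move=> x s /cf; apply: halts_weaken => //; rewrite leq_addl.
Qed.

Lemma polytime_bounded (X Y : encType) (f : X -> Y) : polytime f ->
  exists2 p, polygrowth p & forall x, code_size (f x) <= p (code_size x).
Proof. by move=> [_ [_ [p [pp le_f _]]]]; exists p. Qed.

Lemma polytime_recode (X Y Z : encType) (f : X -> Y) (g : X -> Z) :
  (forall x, code (f x) = code (g x)) -> polytime f -> polytime g.
Proof.
move=> fg [c [N [p [pp le_f cf]]]]; exists c, N, p; split=> //.
  by move=> x; rewrite /code_size -fg le_f.
by move=> x s s0; apply: halts_weaken (cf x s s0) => // s'; rewrite fg.
Qed.

Lemma polytime_ext (X Y : encType) (f g : X -> Y) :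
  f =1 g -> polytime f -> polytime g.
Proof. by move=> fg; apply: polytime_recode => x; rewrite fg. Qed.

Lemma polytime_expr (X Y : encType) (f : X -> Y) e p : polygrowth p ->
  (forall x s, s 0 = code x -> eval s e = code (f x)) ->
  (forall x, code_size (f x) <= p (code_size x)) -> polytime f.
Proof.
move=> pp ef le_f.
apply: (polytime_intro (c := CAssign 0 e) (N := 1) pp
  (polygrowth_const (etime e).+1)) => // x s s0.
apply: halts_assign; rewrite upd_eq (ef x) //; split=> // y y_gt0.
by rewrite upd_neq // -lt0n.
Qed.

Lemma polytime_id (X : encType) : polytime (fun x : X => x).
Proof. exact: (polytime_expr (e := EVar 0) polygrowth_id). Qed.

Lemma polytime_const (X Y : encType) (y : Y) : polytime (fun _ : X => y).
Proof.
exact: (polytime_expr (e := EConst (code y)) (polygrowth_const (code_size y))).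
Qed.

Lemma polytime_comp (X Y Z : encType) (f : X -> Y) (g : Y -> Z) :
  polytime f -> polytime g -> polytime (fun x => g (f x)).
Proof.
move=> [c [N [p [pp le_f cf]]]] [d [M [q [pq le_g dg]]]].
have [mono_q _] := pq; have pqp := polygrowth_comp pp pq.
apply: (polytime_intro (c := CSeq c d) (N := maxn N M) pqp
  (polygrowth_add pp pqp)) => [x|x s s0].
  by rewrite (leq_trans (le_g _)) ?mono_q.
apply: halts_seq; apply: halts_weaken (cf x s s0) => // s1 [s10 frame1].
apply: halts_weaken (dg _ s1 s10) => [|s2 [s20 frame2]]; first exact: mono_q.
by split=> // y; rewrite geq_max => /andP[Ny My]; rewrite frame2 // frame1.
Qed.

Lemma polytime_pair (X Y Z : encType) (f : X -> Y) (g : X -> Z) :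
  polytime f -> polytime g -> polytime (fun x => (f x, g x)).
Proof.
move=> [c [N [p [pp le_f cf]]]] [d [M [q [pq le_g dg]]]].
pose K := (maxn N M).+1.
have {}cf : computes c K f p by apply: computes_weaken cf; rewrite leqW ?leq_maxl.
have {}dg : computes d K g q by apply: computes_weaken dg; rewrite leqW ?leq_maxr.
apply: (polytime_intro (N := K.+2) (p := fun n => p n + q n + 1)
  (q := fun n => 2 + (p n + (2 + (2 + (q n + 4)))))
  (c := CSeq (CAssign K (EVar 0)) (CSeq c (CSeq (CAssign K.+1 (EVar 0))
    (CSeq (CAssign 0 (EVar K))
      (CSeq d (CAssign 0 (ECons (EVar K.+1) (EVar 0))))))))).
- by auto with growth.
- by auto 10 with growth.
- by move=> x; rewrite code_size_pair addn1 ltnS leq_add.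
move=> x s s0; apply: halts_seq; apply: (halts_assign (e := EVar _)).
rewrite /= s0; apply: halts_seq; apply: halts_weaken (cf x _ _) => // s1 [s10 frame1].
apply: halts_seq; apply: (halts_assign (e := EVar _)); rewrite /= s10.
apply: halts_seq; apply: (halts_assign (e := EVar _)).
have -> : eval (upd s1 K.+1 (code (f x))) (EVar K) = code x.
  by rewrite /= upd_neq ?neq_ltn ?ltnSn // frame1 // upd_eq.
apply: halts_seq; apply: halts_weaken (dg x _ _) => // s2 [s20 frame2].
apply: (halts_assign (e := ECons _ _)); rewrite /= s20 frame2 //; split=> [|y Ky].
  by rewrite upd_eq upd_neq // upd_eq.
have [y0 yK yK1] : [/\ y != 0, y != K & y != K.+1].
  by split; apply/eqP; lia.
by rewrite upd_neq // frame2 ?upd_neq ?frame1 ?upd_neq //; lia.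
Qed.

Lemma polytime_comp2 (X Y Z T : encType) (f : X -> Y) (g : X -> Z)
    (h : Y -> Z -> T) :
  polytime (fun z : Y * Z => h z.1 z.2) -> polytime f -> polytime g ->
  polytime (fun x => h (f x) (g x)).
Proof. by move=> ph pf pg; apply: (polytime_comp (polytime_pair pf pg) ph). Qed.

Lemma polytime_comp3 (X Y Z T S : encType) (f : X -> Y) (g : X -> Z) (h : X -> T)
    (k : Y -> Z -> T -> S) :
  polytime (fun z : Y * Z * T => k z.1.1 z.1.2 z.2) ->
  polytime f -> polytime g -> polytime h -> polytime (fun x => k (f x) (g x) (h x)).
Proof.
move=> pk pf pg ph; exact: (polytime_comp (polytime_pair (polytime_pair pf pg) ph) pk).
Qed.

Lemma polytime_fst (X Y Z : encType) (f : X -> Y * Z) :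
  polytime f -> polytime (fun x => (f x).1).
Proof.
move/polytime_comp; apply; apply: (polytime_expr (e := EHd (EVar 0)) polygrowth_id).
  by move=> x s /= ->.
by move=> [y z]; rewrite code_size_pair -addnS leq_addr.
Qed.

Lemma polytime_snd (X Y Z : encType) (f : X -> Y * Z) :
  polytime f -> polytime (fun x => (f x).2).
Proof.
move/polytime_comp; apply; apply: (polytime_expr (e := ETl (EVar 0)) polygrowth_id).
  by move=> x s /= ->.
by move=> [y z]; rewrite code_size_pair -addSn leq_addl.
Qed.

Lemma polytime_behead (X Y : encType) (f : X -> seq Y) :
  polytime f -> polytime (fun x => behead (f x)).
Proof.
move/polytime_comp; apply; apply: (polytime_expr (e := ETl (EVar 0)) polygrowth_id).
  by move=> [|y r] s /= ->.
by move=> [|y r] //; rewrite code_size_cons -addSn leq_addl.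
Qed.

Lemma polytime_if (X Y : encType) (b : X -> bool) (f g : X -> Y) :
  polytime b -> polytime f -> polytime g ->
  polytime (fun x => if b x then f x else g x).
Proof.
move=> pb pf pg.
apply: (polytime_comp (polytime_pair pb (polytime_pair pf pg))
  (g := fun z : bool * (Y * Y) => if z.1 then z.2.1 else z.2.2)).
apply: (polytime_intro (N := 1) (p := id) (q := fun=> 7)
  (c := CIf (EHd (EVar 0)) (CAssign 0 (EHd (ETl (EVar 0))))
    (CAssign 0 (ETl (ETl (EVar 0)))))).
- exact: polygrowth_id.
- exact: polygrowth_const.
- by move=> [[] [y1 y2]]; rewrite !code_size_pair /=; lia.
have frame s d y : 1 <= y -> upd s 0 d y = s y by move=> y_gt0; rewrite upd_neq -?lt0n.
move=> [b0 [y1 y2]] s s0; apply: (halts_if (e := EHd _) (T := 4)); rewrite /= s0 => bE.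
  apply: (halts_assign (e := EHd _)).
  by case: b0 bE s0 => //= _ ->; split=> // y /frame->.
apply: (halts_assign (e := ETl _)).
by case: b0 bE s0 => //= _ ->; split=> // y /frame->.
Qed.

(** * Bounded iteration *)

Section Loop.
Variables (X Y E : encType) (step : X -> Y -> E -> Y).
Variables (c : cmd) (K : nat) (p : nat -> nat).
Hypothesis K_gt0 : 0 < K.
Hypothesis mono_p : {homo p : m n / m <= n}.
Hypothesis c_step :
  computes c K (fun z : X * (Y * E) => step z.1 z.2.1 z.2.2) p.

Definition fold_loop : cmd :=
  CWhile (EVar K.+1)
    (CSeq (CAssign 0 (ECons (EVar K) (ECons (EVar 0) (EHd (EVar K.+1)))))
      (CSeq c (CAssign K.+1 (ETl (EVar K.+1))))).

Lemma halts_fold_loop x B M l y s :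
  s 0 = code y -> s K = code x -> s K.+1 = code l ->
  (forall l1 l2, l = l1 ++ l2 -> code_size (foldl (step x) y l1) <= B) ->
  code_size x + B + code_size l <= M ->
  halts fold_loop s (size l * (p M + 12) + 2)
    (fun s' => s' 0 = code (foldl (step x) y l) /\
               forall v, K.+2 <= v -> s' v = s v).
Proof.
elim: l y s => [|e l IH] y s s0 sK sl leB leM.
  by apply: (halts_while_false (e := EVar _)).
have sizes : code_size (x, (y, e)) <= M.
  by have := leB [::] _ erefl; rewrite !code_size_pair /= in leM *; move: leM;
    rewrite code_size_cons; have := code_size_gt0 l; lia.
apply: (@halts_weaken _ _ (1 + (7 + (p M + 3)) + (size l * (p M + 12) + 2)).+1
  _ _ _ _ (fun s' h => h)); first by rewrite /= mulSn; lia.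
apply: (halts_while_true (e := EVar _)); first by rewrite /= sl.
apply: halts_seq; apply: (halts_assign (e := ECons _ _)); rewrite /= sK s0 sl /=.
set s1 := upd s 0 _.
have s10 : s1 0 = code (x, (y, e)) by rewrite /s1 upd_eq.
apply: halts_seq; apply: halts_weaken (c_step s10) => [|s2 [s20 frame2]].
  exact: mono_p.
apply: (halts_assign (e := ETl _)).
have frame1 v : K <= v -> s2 v = s v.
  by move=> Kv; rewrite frame2 // /s1 upd_neq //; lia.
rewrite /= frame1 // sl /=.
set s3 := upd s2 K.+1 _.
have s30 : s3 0 = code (step x y e) by rewrite /s3 upd_neq.
have s3K : s3 K = code x by rewrite /s3 upd_neq ?frame1 ?ltn_eqF.
have s3l : s3 K.+1 = code l by rewrite /s3 upd_eq.
apply: halts_weaken (IH _ _ s30 s3K s3l _ _) => // [s' [s'0 frame']|l1 l2 ll|].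
- split=> // v Kv; rewrite frame' // /s3 upd_neq ?frame1 //; lia.
- by apply: (leB (e :: l1) l2); rewrite ll.
- by move: leM; rewrite code_size_cons; lia.
Qed.

Variables (y0 : X -> Y) (l : X -> seq E) (cy cl : cmd) (py pl B : nat -> nat).
Hypothesis cy_y0 : computes cy K y0 py.
Hypothesis cl_l : computes cl K l pl.
Hypothesis le_l : forall x, code_size (l x) <= pl (code_size x).
Hypothesis le_B : forall x l1 l2, l x = l1 ++ l2 ->
  code_size (foldl (step x) (y0 x) l1) <= B (code_size x).

Definition fold_program : cmd :=
  CSeq (CAssign K (EVar 0)) (CSeq cl (CSeq (CAssign K.+1 (EVar 0))
    (CSeq (CAssign 0 (EVar K)) (CSeq cy fold_loop)))).

Lemma computes_foldl :
  computes fold_program K.+2 (fun x => foldl (step x) (y0 x) (l x))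
    (fun n => 2 + (pl n + (2 + (2 +
      (py n + (pl n * (p (n + B n + pl n) + 12) + 2)))))).
Proof.
move=> x s s0; apply: halts_seq; apply: (halts_assign (e := EVar _)).
rewrite /= s0; set s1 := upd s K _.
have s10 : s1 0 = code x by rewrite /s1 upd_neq // ltn_eqF.
apply: halts_seq; apply: halts_weaken (cl_l s10) => // s2 [s20 frame2].
apply: halts_seq; apply: (halts_assign (e := EVar _)); rewrite /= s20.
apply: halts_seq; apply: (halts_assign (e := EVar _)).
have -> : eval (upd s2 K.+1 (code (l x))) (EVar K) = code x.
  by rewrite /= upd_neq ?ltn_eqF // frame2 // /s1 upd_eq.
set s3 := upd _ 0 _; have s30 : s3 0 = code x by rewrite /s3 upd_eq.
apply: halts_seq; apply: halts_weaken (cy_y0 s30) => // s4 [s40 frame4].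
have s4K : s4 K = code x.
  by rewrite frame4 // /s3 upd_neq ?gtn_eqF // upd_neq ?ltn_eqF // frame2 // /s1 upd_eq.
have s4l : s4 K.+1 = code (l x) by rewrite frame4 // /s3 upd_neq // upd_eq.
have leM : code_size x + B (code_size x) + code_size (l x) <=
    code_size x + B (code_size x) + pl (code_size x) by rewrite leq_add2l.
apply: halts_weaken (halts_fold_loop s40 s4K s4l (le_B (x := x)) leM).
  rewrite leq_add2r leq_mul //.
  exact: leq_trans (ltnW (ltn_size_code_size _)) (le_l x).
move=> s5 [s50 frame5]; split=> // v Kv.
by rewrite frame5 // frame4 ?/s3 ?upd_neq ?frame2 ?/s1 ?upd_neq //; lia.
Qed.

End Loop.

(** It is enough that the intermediate results stay small, since the number of
    iterations is at most the size of the list. *)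
Lemma polytime_foldl (X Y E : encType) (step : X -> Y -> E -> Y)
    (y0 : X -> Y) (l : X -> seq E) p :
  polytime (fun z : X * (Y * E) => step z.1 z.2.1 z.2.2) ->
  polytime y0 -> polytime l -> polygrowth p ->
  (forall x r, code_size (foldl (step x) (y0 x) r) <=
     p (code_size x + code_size (y0 x) + code_size r)) ->
  polytime (fun x => foldl (step x) (y0 x) (l x)).
Proof.
move=> [cs [Ns [ps [gps _ cps]]]] [cy [Ny [py [gpy le_y cpy]]]].
move=> [cl [Nl [pl [gpl le_l cpl]]]] gp le_p.
pose K := (maxn Ns (maxn Ny Nl)).+1.
have [leNs leNy leNl] : [/\ Ns <= K, Ny <= K & Nl <= K] by split; rewrite /K; lia.
move: cps cpy cpl => /(computes_weaken leNs) cps /(computes_weaken leNy) cpy.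
move/(computes_weaken leNl) => cpl; have [[mono_p _] [mono_s _]] := (gp, gps).
pose B n := p (n + py n + pl n).
have gB : polygrowth B by apply: polygrowth_comp gp; auto with growth.
have le_B x l1 l2 : l x = l1 ++ l2 ->
    code_size (foldl (step x) (y0 x) l1) <= B (code_size x).
  move=> lx; rewrite (leq_trans (le_p _ _)) ?mono_p // leq_add ?leq_add2l //.
  by rewrite (leq_trans _ (le_l x)) // lx leq_code_size_catl.
have fold := computes_foldl (ltn0Sn _) mono_s cps cpy cpl le_l le_B.
apply: (polytime_intro gB _ _ fold) => [|x].
  have gM : polygrowth (fun n => n + B n + pl n) by auto with growth.
  by have := polygrowth_comp gM gps; auto 15 with growth.
by apply: (le_B x _ [::]); rewrite cats0.
Qed.

Lemma polytime_foldl_additive (X Y E : encType) (step : X -> Y -> E -> Y)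
    (y0 : X -> Y) (l : X -> seq E) p :
  polytime (fun z : X * (Y * E) => step z.1 z.2.1 z.2.2) ->
  polytime y0 -> polytime l -> polygrowth p ->
  (forall x y e, code_size (step x y e) <=
     code_size y + p (code_size x + code_size e)) ->
  polytime (fun x => foldl (step x) (y0 x) (l x)).
Proof.
move=> pstep py pl gp le_step; have [mono_p _] := gp.
apply: (polytime_foldl (p := fun n => n + n * p n)); auto with growth.
move=> x r; elim/last_ind: r => [|r e IH].
  by rewrite (leq_trans _ (leq_addr _ _)) // addnAC leq_addl.
rewrite foldl_rcons code_size_rcons; apply: leq_trans (le_step _ _ _) _.
move: IH; set y := foldl _ _ _; set m := _ + code_size r; set n := _ + _.+1.
move=> le_y; have [mn en] : m < n /\ code_size x + code_size e <= n.
  by rewrite /m /n; lia.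
have := mono_p _ _ en; have := leq_mul (leqnn m) (mono_p _ _ (ltnW mn)).
by have := leq_mul mn (leqnn (p n)); rewrite mulSn; lia.
Qed.

(** * Booleans and lists *)

Create HintDb polytime discriminated.
#[local] Hint Constants Opaque : polytime.
#[local] Hint Resolve polytime_id polytime_const polytime_fst polytime_snd
  polytime_behead polytime_pair polytime_if : polytime.

Ltac polytime := auto 60 with polytime growth.

Lemma polytime_negb (X : encType) (b : X -> bool) :
  polytime b -> polytime (fun x => ~~ b x).
Proof. by move=> pb; apply: polytime_if; polytime. Qed.

Lemma polytime_andb (X : encType) (b c : X -> bool) :
  polytime b -> polytime c -> polytime (fun x => b x && c x).
Proof. by move=> pb pc; apply: polytime_if; polytime. Qed.

Lemma polytime_orb (X : encType) (b c : X -> bool) :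
  polytime b -> polytime c -> polytime (fun x => b x || c x).
Proof. by move=> pb pc; apply: polytime_if; polytime. Qed.
#[local] Hint Resolve polytime_negb polytime_andb polytime_orb : polytime.

Lemma polytime_implb (X : encType) (b c : X -> bool) :
  polytime b -> polytime c -> polytime (fun x => b x ==> c x).
Proof. by move=> pb pc; apply: polytime_if; polytime. Qed.

Lemma polytime_addb (X : encType) (b c : X -> bool) :
  polytime b -> polytime c -> polytime (fun x => b x (+) c x).
Proof.
move=> pb pc; apply: (@polytime_ext _ _ (fun x => if b x then ~~ c x else c x)).
  by move=> x; case: (b x).
by apply: polytime_if; polytime.
Qed.
#[local] Hint Resolve polytime_implb polytime_addb : polytime.

Lemma polytime_cons (X Y : encType) (f : X -> Y) (s : X -> seq Y) :
  polytime f -> polytime s -> polytime (fun x => f x :: s x).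
Proof. by move=> pf ps; apply: polytime_recode (polytime_pair pf ps). Qed.
#[local] Hint Resolve polytime_cons : polytime.

Lemma polytime_nilp (X Y : encType) (s : X -> seq Y) :
  polytime s -> polytime (fun x => nilp (s x)).
Proof.
move=> ps; apply: (@polytime_ext _ _ (fun x => foldl (fun _ _ => false) true (s x))).
  by move=> x; case: (s x) => // y r; elim: r y.
apply: (polytime_foldl_additive _ _ ps (polygrowth_const 1)); polytime.
by move=> x y e; rewrite addn1.
Qed.

Lemma foldl_cons_map (S T : Type) (f : S -> T) s t :
  foldl (fun r x => f x :: r) t s = catrev (map f s) t.
Proof. by elim: s t => /=. Qed.

Lemma polytime_catrev (X Y : encType) (s t : X -> seq Y) :
  polytime s -> polytime t -> polytime (fun x => catrev (s x) (t x)).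
Proof.
move=> ps pt.
apply: (@polytime_ext _ _ (fun x => foldl (fun r y => y :: r) (t x) (s x))).
  by move=> x; rewrite foldl_cons_map map_id.
apply: (polytime_foldl_additive (p := fun n => n + 1)); polytime.
by move=> x r y; rewrite code_size_cons; lia.
Qed.

Lemma polytime_rev (X Y : encType) (s : X -> seq Y) :
  polytime s -> polytime (fun x => rev (s x)).
Proof. by move=> ps; apply: polytime_catrev; polytime. Qed.
#[local] Hint Resolve polytime_nilp polytime_rev polytime_catrev : polytime.

Lemma polytime_cat (X Y : encType) (s t : X -> seq Y) :
  polytime s -> polytime t -> polytime (fun x => s x ++ t x).
Proof.
move=> ps pt; apply: (@polytime_ext _ _ (fun x => catrev (rev (s x)) (t x))).
  by move=> x; rewrite catrevE revK.
by polytime.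
Qed.
#[local] Hint Resolve polytime_cat : polytime.

Lemma polytime_map (X Y Z : encType) (f : X -> Y -> Z) (s : X -> seq Y) :
  polytime (fun z : X * Y => f z.1 z.2) -> polytime s ->
  polytime (fun x => [seq f x y | y <- s x]).
Proof.
move=> pf ps; have [p gp le_f] := polytime_bounded pf.
apply: (@polytime_ext _ _ (fun x => rev (foldl (fun r y => f x y :: r) [::] (s x)))).
  by move=> x; rewrite foldl_cons_map -/(rev _) revK.
apply: polytime_rev.
apply: (polytime_foldl_additive (p := fun n => (p n.+1).+1)) => //.
- by apply: polytime_cons; [apply: (polytime_comp2 pf)|]; polytime.
- by polytime.
- by apply/polygrowth_succ/(polygrowth_comp _ gp)/polygrowth_succ/polygrowth_id.
by move=> x r y; have := le_f (x, y); rewrite code_size_cons code_size_pair /=; lia.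
Qed.

Lemma foldl_flatten (T : Type) (t : seq T) ss : foldl cat t ss = t ++ flatten ss.
Proof. by elim: ss t => [|s ss IH] t /=; rewrite ?cats0 // IH catA. Qed.

Lemma polytime_flatten (X Y : encType) (s : X -> seq (seq Y)) :
  polytime s -> polytime (fun x => flatten (s x)).
Proof.
move=> ps; apply: (@polytime_ext _ _ (fun x => foldl cat [::] (s x))).
  by move=> x; rewrite foldl_flatten.
apply: (polytime_foldl_additive (p := id)); polytime.
by move=> x r t; have := code_size_cat r t; lia.
Qed.
#[local] Hint Resolve polytime_map polytime_flatten : polytime.

Lemma polytime_filter (X Y : encType) (p : X -> Y -> bool) (s : X -> seq Y) :
  polytime (fun z : X * Y => p z.1 z.2) -> polytime s ->
  polytime (fun x => [seq y <- s x | p x y]).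
Proof.
move=> pp ps; apply: (@polytime_ext _ _
  (fun x => flatten [seq if p x y then [:: y] else [::] | y <- s x])).
  by move=> x; elim: (s x) => //= y r ->; case: (p x y).
by polytime.
Qed.
#[local] Hint Resolve polytime_filter : polytime.

Lemma polytime_all (X Y : encType) (p : X -> Y -> bool) (s : X -> seq Y) :
  polytime (fun z : X * Y => p z.1 z.2) -> polytime s ->
  polytime (fun x => all (p x) (s x)).
Proof.
move=> pp ps; apply: (@polytime_ext _ _ (fun x => nilp [seq y <- s x | ~~ p x y])).
  by move=> x; elim: (s x) => //= y r IH; case: (p x y).
by polytime.
Qed.

Lemma polytime_has (X Y : encType) (p : X -> Y -> bool) (s : X -> seq Y) :
  polytime (fun z : X * Y => p z.1 z.2) -> polytime s ->
  polytime (fun x => has (p x) (s x)).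
Proof.
move=> pp ps; apply: (@polytime_ext _ _ (fun x => ~~ all (fun y => ~~ p x y) (s x))).
  by move=> x; rewrite -has_predC; apply: eq_has => y /=; rewrite negbK.
by apply: polytime_negb; apply: polytime_all; polytime.
Qed.
#[local] Hint Resolve polytime_all polytime_has : polytime.

Lemma polytime_take1 (X Y : encType) (s : X -> seq Y) :
  polytime s -> polytime (fun x => take 1 (s x)).
Proof.
move=> ps; apply: (@polytime_ext _ _
  (fun x => foldl (fun r y => if nilp r then [:: y] else r) [::] (s x))).
  by move=> x; case: (s x) => //= y r; rewrite take0; elim: r.
apply: (polytime_foldl_additive (p := fun n => n.+1)); polytime.
by move=> x [|z r] y; rewrite /= ?code_size_cons; lia.
Qed.
#[local] Hint Resolve polytime_take1 : polytime.

Lemma foldl_zip (S T : Type) (s : seq S) (t : seq T) r :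
  foldl (fun r y => (behead r.1, [seq (y, z) | z <- take 1 r.1] ++ r.2)) (t, r) s =
  (drop (size s) t, catrev (zip s t) r).
Proof.
elim: s t r => [|y s IH] [|z t] r //=; rewrite ?take0 IH //.
by case: s {IH}.
Qed.

Lemma polytime_zip (X Y Z : encType) (s : X -> seq Y) (t : X -> seq Z) :
  polytime s -> polytime t -> polytime (fun x => zip (s x) (t x)).
Proof.
move=> ps pt; apply: (@polytime_ext _ _ (fun x => rev (foldl (fun r y =>
  (behead r.1, [seq (y, z) | z <- take 1 r.1] ++ r.2)) (t x, [::]) (s x)).2)).
  by move=> x; rewrite foldl_zip -/(rev _) revK.
apply/polytime_rev/polytime_snd.
apply: (polytime_foldl_additive (p := fun n => n.+1)); auto 8 with growth.
- by polytime.
- by polytime.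
by move=> x [[|z r] r'] y /=; rewrite ?take0 /= !(code_size_pair, code_size_cons); lia.
Qed.
#[local] Hint Resolve polytime_zip : polytime.

(** * Binary arithmetic *)

Definition nat_of_bits (s : seq bool) : nat :=
  foldr (fun (b : bool) n => b + n.*2) 0 s.

Lemma nat_of_bits_rcons s (b : bool) :
  nat_of_bits (rcons s b) = nat_of_bits s + b * 2 ^ size s.
Proof. by elim: s => [|c s IH] /=; rewrite ?muln1 ?addn0 // IH expnS; lia. Qed.

Lemma nat_bits_cons (b : bool) n :
  nat_bits (b + n.*2) = if b || (0 < n) then b :: nat_bits n else [::].
Proof.
case: ifP => [bn|]; last by case: b; case: n.
have N_gt0 : 0 < b + n.*2 by case: b bn => // /=; lia.
rewrite /nat_bits up_log2S // half_bit_double /= expn0 divn1 oddD odd_double addbF oddb.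
congr cons; rewrite (iotaDl 1 0) -map_comp; apply: eq_map => i /=.
by rewrite expnS divnMA divn2 half_bit_double.
Qed.

Lemma nat_bitsK : cancel nat_bits nat_of_bits.
Proof.
move=> n; elim/ltn_ind: n => n IH; rewrite -(odd_double_half n) nat_bits_cons.
case: ifP => [odd_or_gt0|]; last by case: (odd n); case: (n./2).
rewrite /= IH // -[X in _ < X](odd_double_half n).
by move: odd_or_gt0; case: (odd n) => /=; lia.
Qed.

Definition trim_zeros (s : seq bool) : seq bool :=
  foldr (fun b r => if b || ~~ nilp r then b :: r else [::]) [::] s.

Lemma nat_of_bitsK s : nat_bits (nat_of_bits s) = trim_zeros s.
Proof.
elim: s => //= b s IH; rewrite nat_bits_cons.
have -> : (0 < nat_of_bits s) = ~~ nilp (nat_bits (nat_of_bits s)).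
  by rewrite lt0n -(inj_eq (can_inj nat_bitsK)); case: (nat_bits _).
by rewrite IH.
Qed.

Lemma size_nat_bits_leq n k : (size (nat_bits n) <= k) = (n < 2 ^ k).
Proof.
rewrite size_map size_iota; apply/idP/idP => [le_k|]; last exact: up_log_min.
by rewrite (leq_trans (up_logP n.+1 (ltnSn 1))) ?leq_exp2l.
Qed.

Lemma code_size_bits_bounds (s : seq bool) :
  2 * size s < code_size s <= 4 * size s + 1.
Proof.
elim: s => // b s IH; rewrite code_size_cons /=.
by have := code_size_bool b; have := code_size_gt0 b; lia.
Qed.

Lemma code_size_nat n : code_size n = code_size (nat_bits n).
Proof. by []. Qed.

Lemma ltn_exp_code_size n : n < 2 ^ code_size n.
Proof.
rewrite -size_nat_bits_leq code_size_nat.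
by have /andP[+ _] := code_size_bits_bounds (nat_bits n); lia.
Qed.

Lemma code_size_ltn_exp n k : n < 2 ^ k -> code_size n <= 4 * k + 1.
Proof.
rewrite -size_nat_bits_leq code_size_nat => le_k.
by have /andP[_] := code_size_bits_bounds (nat_bits n); lia.
Qed.

Lemma leq_code_size_nat m n : m <= n -> code_size m <= 4 * code_size n + 1.
Proof. by move=> mn; apply/code_size_ltn_exp/(leq_ltn_trans mn)/ltn_exp_code_size. Qed.

Lemma polytime_nat_bits (X : encType) (f : X -> nat) :
  polytime f -> polytime (fun x => nat_bits (f x)).
Proof. exact: polytime_recode. Qed.

Lemma polytime_nat_of_bits (X : encType) (s : X -> seq bool) :
  polytime s -> polytime (fun x => nat_of_bits (s x)).
Proof.
move=> ps; apply: (@polytime_recode _ _ _ (fun x => foldl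
  (fun r b => if b || ~~ nilp r then b :: r else [::]) [::] (rev (s x)))).
  by move=> x; rewrite foldl_rev -/(trim_zeros _) -nat_of_bitsK.
apply: (polytime_foldl_additive (p := fun n => n.+1)); polytime.
move=> x r b; have := code_size_gt0 r.
by case: ifP => _; rewrite ?code_size_cons ?code_size_nil; lia.
Qed.
#[local] Hint Resolve polytime_nat_bits polytime_nat_of_bits : polytime.

Definition pad_zip (s t : seq bool) : seq (bool * bool) :=
  zip (s ++ [seq false | _ <- t]) (t ++ [seq false | _ <- s]).

(** The final carry and the digits of the sum, most significant digit first. *)
Definition ripple (ps : seq (bool * bool)) : bool * seq bool :=
  foldl (fun r p => (r.1 && (p.1 || p.2) || p.1 && p.2, r.1 (+) p.1 (+) p.2 :: r.2))
    (false, [::]) ps.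

Lemma rippleP ps (r := ripple ps) : size r.2 = size ps /\
  nat_of_bits (rev r.2) + r.1 * 2 ^ size ps =
  nat_of_bits (unzip1 ps) + nat_of_bits (unzip2 ps).
Proof.
rewrite {}/r; elim/last_ind: ps => // ps [b c] [IHsize IH].
rewrite /ripple foldl_rcons -/(ripple ps) /= rev_cons !size_rcons IHsize; split=> //.
rewrite /unzip1 /unzip2 !map_rcons !nat_of_bits_rcons size_rev IHsize !size_map expnS.
move: IH; rewrite /unzip1 /unzip2; move: (2 ^ _) => w.
by case: (ripple ps).1; case: b; case: c => /=; lia.
Qed.

Lemma nat_of_bits_pad (T : Type) s (t : seq T) :
  nat_of_bits (s ++ [seq false | _ <- t]) = nat_of_bits s.
Proof. by elim: s => [|b s /= -> //]; elim: t => //= _ t ->. Qed.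

Lemma nat_of_bits_unzip1_pad_zip s t :
  nat_of_bits (unzip1 (pad_zip s t)) = nat_of_bits s.
Proof. by rewrite unzip1_zip ?nat_of_bits_pad // !size_cat !size_map addnC. Qed.

Lemma nat_of_bits_unzip2_pad_zip s t :
  nat_of_bits (unzip2 (pad_zip s t)) = nat_of_bits t.
Proof. by rewrite unzip2_zip ?nat_of_bits_pad // !size_cat !size_map addnC. Qed.

Lemma polytime_pad_zip (X : encType) (s t : X -> seq bool) :
  polytime s -> polytime t -> polytime (fun x => pad_zip (s x) (t x)).
Proof. by move=> ps pt; apply: polytime_zip; polytime. Qed.

Lemma polytime_ripple (X : encType) (ps : X -> seq (bool * bool)) :
  polytime ps -> polytime (fun x => ripple (ps x)).
Proof.
move=> pps; apply: (polytime_foldl_additive (p := fun=> 6)); polytime.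
move=> x [c r] [b1 b2]; rewrite !code_size_pair code_size_cons.
set carry := _ || _; set digit := _ (+) _.
have := code_size_bool carry; have := code_size_bool digit.
by have := code_size_gt0 c => /=; lia.
Qed.
#[local] Hint Resolve polytime_pad_zip polytime_ripple : polytime.

Lemma polytime_addn (X : encType) (f g : X -> nat) :
  polytime f -> polytime g -> polytime (fun x => f x + g x).
Proof.
move=> pf pg; pose r x := ripple (pad_zip (nat_bits (f x)) (nat_bits (g x))).
apply: (@polytime_ext _ _ (fun x => nat_of_bits (rev ((r x).1 :: (r x).2)))).
  move=> x; rewrite /r rev_cons nat_of_bits_rcons size_rev.
  have [-> ->] := rippleP (pad_zip (nat_bits (f x)) (nat_bits (g x))).
  by rewrite nat_of_bits_unzip1_pad_zip nat_of_bits_unzip2_pad_zip !nat_bitsK.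
by rewrite /r; polytime.
Qed.

(** Complementing the digits of [m] turns it into [2 ^ k - 1 - m], so that the
    sum with [n] overflows if and only if [m < n], and complementing the sum
    gives back [m - n] otherwise. *)
Definition borrow (m n : nat) : bool * seq bool :=
  ripple [seq (~~ p.1, p.2) | p <- pad_zip (nat_bits m) (nat_bits n)].

Lemma nat_of_bits_negb s :
  nat_of_bits s + nat_of_bits (map negb s) + 1 = 2 ^ size s.
Proof. by elim: s => //= b s IH; rewrite expnS -IH; case: b; lia. Qed.

Lemma nat_of_bits_lt s : nat_of_bits s < 2 ^ size s.
Proof. by rewrite -nat_of_bits_negb; lia. Qed.

Lemma borrowP m n (r := borrow m n) : r.1 = (m < n) /\
  (n <= m -> nat_of_bits (map negb (rev r.2)) = m - n).
Proof.
rewrite {}/r /borrow; set ps := pad_zip _ _.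
have [] := rippleP [seq (~~ p.1, p.2) | p <- ps].
set r := ripple _; rewrite size_map => size_r.
have -> : unzip1 [seq (~~ p.1, p.2) | p <- ps] = map negb (unzip1 ps).
  by rewrite /unzip1 -!map_comp.
have -> : unzip2 [seq (~~ p.1, p.2) | p <- ps] = unzip2 ps by rewrite /unzip2 -map_comp.
have eqm : nat_of_bits (unzip1 ps) = m by rewrite nat_of_bits_unzip1_pad_zip nat_bitsK.
have eqn : nat_of_bits (unzip2 ps) = n by rewrite nat_of_bits_unzip2_pad_zip nat_bitsK.
have := nat_of_bits_negb (unzip1 ps); have := nat_of_bits_lt (unzip2 ps).
have := nat_of_bits_negb (rev r.2).
rewrite eqm eqn size_rev size_r !size_map; move: (2 ^ _) => w.
by case: r.1; lia.
Qed.

Lemma polytime_borrow (X : encType) (f g : X -> nat) :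
  polytime f -> polytime g -> polytime (fun x => borrow (f x) (g x)).
Proof. by move=> pf pg; apply: polytime_ripple; polytime. Qed.

Lemma polytime_ltn (X : encType) (f g : X -> nat) :
  polytime f -> polytime g -> polytime (fun x => f x < g x).
Proof.
move=> pf pg; apply: (@polytime_ext _ _ (fun x => (borrow (f x) (g x)).1)).
  by move=> x; case: (borrowP (f x) (g x)).
exact/polytime_fst/polytime_borrow.
Qed.
#[local] Hint Resolve polytime_addn polytime_borrow polytime_ltn : polytime.

Lemma polytime_eqn (X : encType) (f g : X -> nat) :
  polytime f -> polytime g -> polytime (fun x => f x == g x).
Proof.
move=> pf pg; apply: (@polytime_ext _ _ (fun x => ~~ (f x < g x) && ~~ (g x < f x))).
  by move=> x; rewrite -!leqNgt eqn_leq andbC.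
by polytime.
Qed.

Lemma polytime_subn (X : encType) (f g : X -> nat) :
  polytime f -> polytime g -> polytime (fun x => f x - g x).
Proof.
move=> pf pg; apply: (@polytime_ext _ _ (fun x => if f x < g x then 0 else
  nat_of_bits [seq ~~ b | b <- rev (borrow (f x) (g x)).2])).
  move=> x; case: ltnP => [/ltnW/eqP->//|le_gf].
  by case: (borrowP (f x) (g x)) => _ ->.
by polytime.
Qed.
#[local] Hint Resolve polytime_eqn polytime_subn : polytime.

Lemma polytime_minn (X : encType) (f g : X -> nat) :
  polytime f -> polytime g -> polytime (fun x => minn (f x) (g x)).
Proof. by move=> pf pg; apply: polytime_if; polytime. Qed.
#[local] Hint Resolve polytime_minn : polytime.

Lemma foldl_double_add n s :
  foldl (fun r (b : bool) => r + r + (if b then n else 0)) 0 s =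
  nat_of_bits (rev s) * n.
Proof.
rewrite -[in LHS](revK s) foldl_rev; elim: (rev s) => //= b r ->.
by case: b; rewrite mulnDl ?mul1n ?mul0n -addnn mulnDl; lia.
Qed.

Lemma polytime_muln (X : encType) (f g : X -> nat) :
  polytime f -> polytime g -> polytime (fun x => f x * g x).
Proof.
apply: polytime_comp2 => {X f g}.
apply: (@polytime_ext _ _ (fun z => foldl
  (fun r (b : bool) => r + r + (if b then z.2 else 0)) 0 (rev (nat_bits z.1)))).
  by move=> z; rewrite foldl_double_add revK nat_bitsK.
apply: (polytime_foldl (p := fun n => 4 * (n + n) + 1)); polytime.
move=> z s; rewrite foldl_double_add; set n := _ + code_size s.
have lt_z : z.2 < 2 ^ n.
  apply: leq_trans (ltn_exp_code_size _) _; rewrite leq_exp2l // /n.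
  by case: z {n} => z1 z2; rewrite code_size_pair /=; lia.
have lt_s : nat_of_bits (rev s) < 2 ^ n.
  apply: leq_trans (nat_of_bits_lt _) _; rewrite size_rev leq_exp2l //.
  by rewrite (leq_trans (ltnW (ltn_size_code_size s))) // leq_addl.
by apply: code_size_ltn_exp; rewrite expnD ltn_mul.
Qed.
#[local] Hint Resolve polytime_muln : polytime.

Lemma code_size_nat_linear n : code_size n <= 4 * n + 1.
Proof. exact/code_size_ltn_exp/ltn_expl. Qed.

Lemma polytime_size (X Y : encType) (s : X -> seq Y) :
  polytime s -> polytime (fun x => size (s x)).
Proof.
have foldl_succ (l : seq Y) : foldl (fun n _ => 1 + n) 0 l = size l.
  by elim/last_ind: l => // l y IH; rewrite foldl_rcons size_rcons IH.
move=> ps; apply: (polytime_ext (fun x => foldl_succ (s x))).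
apply: (polytime_foldl (p := fun n => 4 * n + 1)); polytime.
move=> x l; rewrite foldl_succ.
by have := code_size_nat_linear (size l); have := ltn_size_code_size l; lia.
Qed.
#[local] Hint Resolve polytime_size : polytime.

Lemma code_size_iota n : code_size (iota 0 n) <= (4 * n + 2) * n + 1.
Proof.
elim: n => // n IH; rewrite -addn1 iotaD cats1 code_size_rcons add0n.
by have := code_size_nat_linear n; nia.
Qed.

Lemma polytime_iota (X Y : encType) (s : X -> seq Y) :
  polytime s -> polytime (fun x => iota 0 (size (s x))).
Proof.
have foldl_iota (l : seq Y) :
    foldl (fun r _ => r ++ [:: size r]) [::] l = iota 0 (size l).
  elim/last_ind: l => // l y IH.
  by rewrite foldl_rcons IH size_iota size_rcons -addn1 iotaD.
move=> ps; apply: (polytime_ext (fun x => foldl_iota (s x))).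
apply: (polytime_foldl (p := fun n => (4 * n + 2) * n + 1)); polytime.
move=> x l; rewrite foldl_iota; apply: leq_trans (code_size_iota _) _.
have le_l : size l <= code_size x + code_size ([::] : seq nat) + code_size l.
  by have := ltn_size_code_size l; lia.
by rewrite leq_add2r leq_mul // leq_add2r leq_mul2l.
Qed.
#[local] Hint Resolve polytime_iota : polytime.

Lemma code_size_nth (X : encType) (x0 : X) s i :
  code_size (nth x0 s i) <= code_size x0 + code_size s.
Proof.
elim: s i => [|x s IH] [|i] /=; rewrite ?code_size_cons ?leq_addr //; first by lia.
by apply: leq_trans (IH i) _; lia.
Qed.

Lemma foldl_nth (T : Type) (x0 : T) i s :
  foldl (fun r x => (1 + r.1, if r.1 == i then x else r.2)) (0, x0) s =
  (size s, nth x0 s i).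
Proof.
elim/last_ind: s => [|s x IH]; first by rewrite nth_nil.
rewrite foldl_rcons IH size_rcons nth_rcons /= eq_sym.
by case: ltngtP => // le_si; rewrite nth_default // ltnW.
Qed.

Lemma polytime_nth (X Y : encType) (y0 : X -> Y) (s : X -> seq Y) (i : X -> nat) :
  polytime y0 -> polytime s -> polytime i ->
  polytime (fun x => nth (y0 x) (s x) (i x)).
Proof.
apply: polytime_comp3 => {X y0 s i}.
apply: (@polytime_ext _ _ (fun z => (foldl
  (fun r y => (1 + r.1, if r.1 == z.2 then y else r.2)) (0, z.1.1) z.1.2).2)).
  by move=> z; rewrite foldl_nth.
apply: polytime_snd.
apply: (polytime_foldl (p := fun n => 5 * n + 2)); polytime.
move=> z l; rewrite foldl_nth !code_size_pair.
have := code_size_nth z.1.1 l z.2; have := code_size_nat_linear (size l).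
by have := ltn_size_code_size l; lia.
Qed.
#[local] Hint Resolve polytime_nth : polytime.

Lemma polytime_mem (X : encType) (f : X -> nat) (s : X -> seq nat) :
  polytime f -> polytime s -> polytime (fun x => f x \in s x).
Proof.
apply: (polytime_comp2 (h := fun n (r : seq nat) => n \in r)) => {X f s}.
apply: (@polytime_ext _ _ (fun z => has (fun y : nat => y == z.1) z.2)).
  by move=> z; rewrite -has_pred1.
by polytime.
Qed.
#[local] Hint Resolve polytime_mem : polytime.

Section NatFoldr.
Variables (op : nat -> nat -> nat) (n0 : nat).
Hypotheses (opA : associative op) (opC : commutative op) (n0_lt2 : n0 < 2).
Hypothesis op_lt :
  forall m n a b, m < 2 ^ a -> n < 2 ^ b -> op m n < 2 ^ (a + b).+1.
Hypothesis polytime_op : polytime (fun z : nat * nat => op z.1 z.2).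

Lemma foldr_ltn_exp s : foldr op n0 s < 2 ^ code_size s.
Proof. by elim: s => // n s IH; exact: op_lt (ltn_exp_code_size n) IH. Qed.

Lemma polytime_foldr_nat (X : encType) (s : X -> seq nat) :
  polytime s -> polytime (fun x => foldr op n0 (s x)).
Proof.
move=> ps; apply: (polytime_ext (fun x => foldl_foldr opA opC n0 (s x))).
apply: (polytime_foldl (p := fun n => 4 * n + 1)); polytime.
  by apply: (polytime_comp2 polytime_op); polytime.
move=> x l; rewrite (foldl_foldr opA opC).
by have := code_size_ltn_exp (foldr_ltn_exp l); lia.
Qed.

End NatFoldr.

Lemma polytime_sumn (X : encType) (s : X -> seq nat) :
  polytime s -> polytime (fun x => sumn (s x)).
Proof.
apply: (polytime_foldr_nat addnA addnC) => // [m n a b|]; last by polytime.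
by rewrite expnS expnD; nia.
Qed.

Definition prodn (s : seq nat) : nat := foldr muln 1 s.

Lemma polytime_prodn (X : encType) (s : X -> seq nat) :
  polytime s -> polytime (fun x => prodn (s x)).
Proof.
apply: (polytime_foldr_nat mulnA mulnC) => // [m n a b|]; last by polytime.
by rewrite expnS expnD; nia.
Qed.
#[local] Hint Resolve polytime_sumn polytime_prodn : polytime.

Definition heaviest (T : Type) (w : T -> nat) (x0 : T) (s : seq T) : T :=
  foldl (fun y x => if w y < w x then x else y) x0 s.

Lemma heaviest_cons (T : Type) (w : T -> nat) x0 x s :
  heaviest w x0 (x :: s) = heaviest w (if w x0 < w x then x else x0) s.
Proof. by []. Qed.

Lemma heaviest_ind (T : eqType) (P : T -> Prop) (w : T -> nat) x0 s :
  P x0 -> {in s, forall x, P x} -> P (heaviest w x0 s).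
Proof.
elim: s x0 => // x s IH x0 Px0 Ps; rewrite heaviest_cons; apply: IH.
  by case: ifP => _ //; apply: Ps; rewrite mem_head.
by move=> y ys; apply: Ps; rewrite inE ys orbT.
Qed.

Lemma heaviest_max (T : eqType) (w : T -> nat) x0 s x :
  x \in x0 :: s -> w x <= w (heaviest w x0 s).
Proof.
elim: s x0 x => [|y s IH] x0 x; rewrite inE; first by move/eqP->.
rewrite heaviest_cons inE => /or3P[/eqP->|/eqP->|xs].
- by apply: leq_trans _ (IH _ _ (mem_head _ _)); case: ltnP => // /ltnW.
- by apply: leq_trans _ (IH _ _ (mem_head _ _)); case: ltnP.
- by apply: IH; rewrite inE xs orbT.
Qed.

Lemma heaviest_map (S T : Type) (f : S -> T) (w : T -> nat) (w' : S -> nat) x0 s :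
  (forall x, w (f x) = w' x) -> heaviest w (f x0) (map f s) = f (heaviest w' x0 s).
Proof.
move=> wf; elim: s x0 => // x s IH x0; rewrite map_cons !heaviest_cons -IH !wf.
by case: ltnP.
Qed.

Lemma code_size_heaviest (X : encType) (w : X -> nat) x0 s :
  code_size (heaviest w x0 s) <= code_size x0 + code_size s.
Proof.
elim: s x0 => [|x s IH] x0; first by rewrite leq_addr.
rewrite heaviest_cons code_size_cons (leq_trans (IH _)) //.
by case: ltnP => _; lia.
Qed.

Lemma polytime_heaviest (X Y : encType) (w : X -> Y -> nat) (y0 : X -> Y)
    (s : X -> seq Y) :
  polytime (fun z : X * Y => w z.1 z.2) -> polytime y0 -> polytime s ->
  polytime (fun x => heaviest (w x) (y0 x) (s x)).
Proof.
move=> pw py ps; apply: (polytime_foldl (p := id)) => // [||x r].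
- apply: polytime_if; polytime.
  by apply: polytime_ltn; apply: (polytime_comp2 pw); polytime.
- by auto with growth.
- by rewrite (leq_trans (code_size_heaviest _ _ _)) // -addnA leq_addl.
Qed.
#[local] Hint Resolve polytime_heaviest : polytime.

(** * Transitive sets and patterns in tournaments *)

Definition septuple (T : Type) : Type :=
  (T * (T * (T * (T * (T * (T * T))))))%type.

Definition septuple_seq (T : Type) (t : septuple T) : seq T :=
  [:: t.1; t.2.1; t.2.2.1; t.2.2.2.1; t.2.2.2.2.1; t.2.2.2.2.2.1; t.2.2.2.2.2.2].

Definition pattern (T : Type) (A : rel T) (t : septuple T) : bool :=
  let v := t.1 in
  let a1 := t.2.1 in let a2 := t.2.2.1 in let a3 := t.2.2.2.1 in
  let b1 := t.2.2.2.2.1 in let b2 := t.2.2.2.2.2.1 in let b3 := t.2.2.2.2.2.2 in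
  [&& [&& A a1 v, A a2 v & A a3 v], [&& A v b1, A v b2 & A v b3],
      [&& A a1 b2 && A a1 b3, A a2 b1 && A a2 b3 & A a3 b1 && A a3 b2]
    & [&& A b1 a1, A b2 a2 & A b3 a3]].

Section Tournament.
Variables (V : finType) (A : rel V).
Hypothesis tour : tournament A.

Lemma arcxx x : A x x = false.
Proof. by case: tour => irr _; exact: irr. Qed.

Lemma arc_neq x y : A x y -> x != y.
Proof. by apply: contraTneq => ->; rewrite arcxx. Qed.

Lemma arc_asym x y : A x y -> A y x = false.
Proof.
move=> xy; case: tour => _ /(_ _ _ (arc_neq xy)).
by rewrite xy /= => /negbTE.
Qed.

Lemma arc_total x y : x != y -> A x y || A y x.
Proof. by case: tour => _ h /h; case: (A x y). Qed.

Definition transitive_set (X : {set V}) : bool :=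
  [forall a in X, forall b in X, forall c in X, A a b ==> A b c ==> A a c].

Lemma transitive_setP (X : {set V}) :
  reflect {in X & &, transitive A} (transitive_set X).
Proof.
apply: (iffP idP) => [tr y x z yX xX zX xy yz|tr].
  move/forall_inP/(_ x xX)/forall_inP/(_ y yX)/forall_inP/(_ z zX): tr.
  by rewrite xy yz.
apply/forall_inP => a aX; apply/forall_inP => b bX; apply/forall_inP => c cX.
by apply/implyP => ab; apply/implyP => bc; apply: (tr b).
Qed.

Lemma transitive_set0 : transitive_set set0.
Proof. by apply/transitive_setP => y x z; rewrite inE. Qed.

Lemma transitive_setS (X Y : {set V}) :
  Y \subset X -> transitive_set X -> transitive_set Y.
Proof.
move=> /subsetP YX /transitive_setP tr; apply/transitive_setP => y x z yY xY zY.
by apply: tr; apply: YX.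
Qed.

Lemma transitive_set_triangle (X : {set V}) a b c : transitive_set X ->
  a \in X -> b \in X -> c \in X -> A a b -> A b c -> A c a = false.
Proof.
by move/transitive_setP=> tr aX bX cX ab bc; apply/arc_asym/(tr b).
Qed.

Lemma transitive_set_no_cycle (X : {set V}) c :
  transitive_set X -> {subset c <= X} -> ~ directed_cycle A c.
Proof.
move=> /transitive_setP tr cX [c_neq0 /andP[cyc _]].
case: c c_neq0 cX cyc => // x p _ cX cyc.
have all_X : all (mem X) (x :: rcons p x).
  by apply/allP => y; rewrite inE mem_rcons orbA orbb => /cX.
have /allP/(_ x) := order_path_min_in tr all_X cyc.
by rewrite mem_rcons mem_head arcxx => /(_ isT).
Qed.

Lemma fvsP S : feedback_vertex_set A S <-> transitive_set (~: S).
Proof.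
split=> [fvs|tr c]; last exact: transitive_set_no_cycle.
apply/transitive_setP => b a c bX aX cX ab bc.
have ac : a != c by apply: contraTneq bc => <-; rewrite (arc_asym ab).
case/orP: (arc_total ac) => // ca; case: (fvs [:: a; b; c]).
  by move=> x; rewrite !inE => /or3P[] /eqP->; rewrite -in_setC.
split=> //; rewrite /ucycle /= ab bc ca /= !inE negb_or ac !andbT.
by rewrite !arc_neq.
Qed.

Definition out_nbr (x : V) : {set V} := [set y | A x y].

Lemma transitive_setU1 q (X : {set V}) :
  transitive_set X -> X \subset out_nbr q -> transitive_set (q |: X).
Proof.
move=> /transitive_setP tr /subsetP qX; apply/transitive_setP => y x z.
have {}qX u : u \in X -> A q u by move/qX; rewrite inE.
rewrite !in_setU1 => /orP[/eqP->|yX] /orP[/eqP->|xX] /orP[/eqP->|zX] //.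
- by rewrite (arc_asym (qX _ xX)).
- by move=> _; rewrite (arc_asym (qX _ yX)).
- by move=> _ _; apply: qX.
- by move=> _; rewrite (arc_asym (qX _ yX)).
- exact: tr.
Qed.

Lemma transitive_set_source (X : {set V}) : transitive_set X -> X != set0 ->
  exists2 q, q \in X & X :\ q \subset out_nbr q.
Proof.
move=> tr /set0Pn[x0 x0X].
case: (arg_maxnP (P := mem X) (fun x => #|X :&: out_nbr x|) x0X) => q /= qX qmax.
exists q => //; apply/subsetP => z; rewrite !inE => /andP[zq zX].
case/orP: (arc_total zq) => // zq_arc.
have : #|X :&: out_nbr z| <= #|X :&: out_nbr q| by exact: qmax.
rewrite leqNgt => /negP[]; apply: proper_card; apply/properP; split.
  apply/subsetP => x; rewrite !inE => /andP[xX qx]; rewrite xX /=.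
  by move/transitive_setP: tr => /(_ q z x); apply.
by exists q; rewrite !inE qX ?zq_arc // arcxx.
Qed.

Lemma pattern_uniq t : pattern A t -> uniq (septuple_seq t).
Proof.
case: t => v [a1 [a2 [a3 [b1 [b2 b3]]]]] /=; rewrite /pattern /=.
case/and4P=> /and3P[a1v a2v a3v] /and3P[vb1 vb2 vb3].
case/and3P=> /andP[a1b2 a1b3] /andP[a2b1 a2b3] /andP[a3b1 a3b2] /and3P[b1a1 b2a2 b3a3].
have neq_path x y z : A x z -> A z y -> x != y.
  by move=> xz; apply: contraTneq => <-; rewrite (arc_asym xz).
have neq_arc x y : A x y -> y != x by rewrite eq_sym; apply: arc_neq.
rewrite !inE !negb_or !andbT.
do ![apply/andP; split]; first [by apply: arc_neq | by apply: neq_arc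
  | match goal with xz : is_true (A ?x ?z), zy : is_true (A ?z ?y)
      |- is_true (?x != ?y) => exact: (neq_path _ _ _ xz zy) end].
Qed.

Lemma fvs_hits_triangle S a b c : feedback_vertex_set A S ->
  A a b -> A b c -> A c a -> [|| a \in S, b \in S | c \in S].
Proof.
move=> /fvsP tr ab bc ca; rewrite -[_ || _]negbK !negb_or -!in_setC.
by apply/negP => /and3P[aS bS cS]; rewrite (transitive_set_triangle tr aS bS) in ca.
Qed.

Lemma fvs_hits_square S a b c d : feedback_vertex_set A S ->
  A a b -> A b c -> A c d -> A d a -> [|| a \in S, b \in S, c \in S | d \in S].
Proof.
move=> fvs ab bc cd da.
have neq_ac : a != c by apply: contraTneq bc => <-; rewrite (arc_asym ab).
case/orP: (arc_total neq_ac) => diag.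
  by case/or3P: (fvs_hits_triangle fvs diag cd da) => ->; rewrite ?orbT.
by case/or3P: (fvs_hits_triangle fvs ab bc diag) => ->; rewrite ?orbT.
Qed.

(** If [v] is kept, one vertex of each pair [a i], [b i] is hit; if [v] is hit,
    at most one of these pairs is kept entirely. *)
Lemma pattern_hits t S : pattern A t -> feedback_vertex_set A S ->
  3 <= count (fun x => x \in S) (septuple_seq t).
Proof.
case: t => v [a1 [a2 [a3 [b1 [b2 b3]]]]]; rewrite /pattern /=.
case/and4P=> /and3P[a1v a2v a3v] /and3P[vb1 vb2 vb3].
case/and3P=> /andP[a1b2 a1b3] /andP[a2b1 a2b3] /andP[a3b1 a3b2].
case/and3P=> b1a1 b2a2 b3a3 fvs.
have := fvs_hits_triangle fvs a1v vb1 b1a1.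
have := fvs_hits_triangle fvs a2v vb2 b2a2.
have := fvs_hits_triangle fvs a3v vb3 b3a3.
have := fvs_hits_square fvs a1b2 b2a2 a2b1 b1a1.
have := fvs_hits_square fvs a1b3 b3a3 a3b1 b1a1.
have := fvs_hits_square fvs a2b3 b3a3 a3b2 b2a2.
move: (v \in S) (a1 \in S) (a2 \in S) (a3 \in S) (b1 \in S) (b2 \in S) (b3 \in S).
by do 7!case.
Qed.

Definition pattern_free (U : {set V}) : Prop :=
  forall t, {subset septuple_seq t <= U} -> ~~ pattern A t.

Definition dominated (U L : {set V}) : {set V} :=
  [set y in U | [forall x in L, A x y]].

Lemma dominatedP (U L : {set V}) y :
  reflect (y \in U /\ {in L, forall x, A x y}) (y \in dominated U L).
Proof. by rewrite inE; apply: (iffP andP) => -[? /forall_inP]. Qed.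

Lemma dominatedS (U L L' : {set V}) :
  L \subset L' -> dominated U L' \subset dominated U L.
Proof.
move=> /subsetP LL'; apply/subsetP => y /dominatedP[yU L'y]; apply/dominatedP.
by split=> // x /LL'/L'y.
Qed.

Lemma dominated0 (U : {set V}) : dominated U set0 = U.
Proof.
apply/setP => y; rewrite inE; case: (y \in U) => //=.
by apply/forall_inP => x; rewrite inE.
Qed.

Lemma dominatedU1 (U L : {set V}) q :
  dominated U (q |: L) = out_nbr q :&: dominated U L.
Proof.
apply/setP => y; rewrite in_setI; apply/dominatedP/andP => [[yU qLy]|[]].
  split; first by rewrite inE qLy ?setU11.
  by apply/dominatedP; split=> // x xL; rewrite qLy ?setU1r.
rewrite inE => qy /dominatedP[yU Ly]; split=> // x.
by rewrite in_setU1 => /orP[/eqP->|/Ly].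
Qed.

Section DominatingSubset.
Variables (U L : {set V}) (q : V).
Hypotheses (LU : L \subset U) (Lq : {in L, forall x, A x q}).

Definition same_dominated (K : {set V}) : bool :=
  (K \subset L) && (dominated U (q |: K) == dominated U (q |: L)).

Lemma private_dominated (K : {set V}) a :
  same_dominated K -> a \in K -> ~~ same_dominated (K :\ a) ->
  exists b, [/\ b \in U, A q b, A b a & {in K :\ a, forall x, A x b}].
Proof.
move=> /andP[KL /eqP domK] aK; rewrite /same_dominated -domK.
rewrite (subset_trans (subD1set _ _) KL) /= eqEsubset.
rewrite [X in _ && X](dominatedS U (setUS _ (subD1set _ _))) andbT.
case/subsetPn => b; rewrite dominatedU1 inE inE => /andP[qb /dominatedP[bU Kb]] nb.
exists b; split=> //.
have aq := Lq (subsetP KL _ aK).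
have ab : a != b by apply: contraTneq aq => ->; rewrite (arc_asym qb).
case/orP: (arc_total ab) => // a_b; case/negP: nb.
rewrite -(setD1K aK) !dominatedU1 !inE qb a_b bU /=.
by apply/forall_inP.
Qed.

Lemma card_minimal_dominating (K : {set V}) : pattern_free U -> q \in U ->
  same_dominated K -> (forall K', same_dominated K' -> #|K| <= #|K'|) -> #|K| <= 2.
Proof.
move=> nopat qU domK Kmin; have [KL _] := andP domK.
have private a : a \in K -> exists b,
    [/\ b \in U, A q b, A b a & {in K :\ a, forall x, A x b}].
  move=> aK; apply: private_dominated => //.
  by apply/negP => /Kmin; rewrite (cardsD1 a K) aK ltnn.
rewrite leqNgt; apply/negP => /card_gt2P[a1 [a2 [a3 [[a1K a2K a3K] [n12 n23 n31]]]]].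
have [b1 [b1U qb1 ba1 Kb1]] := private _ a1K.
have [b2 [b2U qb2 ba2 Kb2]] := private _ a2K.
have [b3 [b3U qb3 ba3 Kb3]] := private _ a3K.
have KU x : x \in K -> x \in U by move/(subsetP KL)/(subsetP LU).
have KQ x : x \in K -> A x q by move/(subsetP KL)/Lq.
have := nopat (q, (a1, (a2, (a3, (b1, (b2, b3)))))); case/(_ _)/negP => [x|].
  rewrite !inE => /or4P[||| /or4P[]] /eqP-> //; exact: KU.
rewrite /pattern /= qb1 qb2 qb3 ba1 ba2 ba3 !KQ // !Kb1 ?Kb2 ?Kb3 //;
  by rewrite !inE eq_sym ?n12 ?n23 ?n31 // eq_sym ?n12 ?n23 ?n31.
Qed.

End DominatingSubset.

Lemma setU1_card_leq2 (K : {set V}) q : #|K| <= 2 ->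
  exists s t, q |: K = [set q; s; t].
Proof.
rewrite leq_eqVlt ltnS => /orP[/cards2P[s [t [_ ->]]]|].
  by exists s, t; rewrite setUA.
rewrite leq_eqVlt ltnS leqn0 cards_eq0 => /orP[/cards1P[s ->]|/eqP->].
  by exists s, s; rewrite -setUA setUid.
by exists q, q; rewrite setU0 !setUid.
Qed.

(** A minimal subset [K] of [L] dominating the same vertices of [out_nbr q]
    gives each of its members a private non-out-neighbour, so three members
    would complete a pattern around [q]. *)
Lemma dominated_by_three (U L : {set V}) q : pattern_free U ->
  q \in U -> L \subset U -> {in L, forall x, A x q} ->
  exists s t, dominated U (q |: L) =
    out_nbr q :&: (out_nbr s :&: (out_nbr t :&: U)).
Proof.
move=> nopat qU LU Lq.
have domL : same_dominated U L q L by rewrite /same_dominated subxx eqxx.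
case: (arg_minnP (fun K : {set V} => #|K|) domL) => K domK Kmin.
have [s [t qK]] := setU1_card_leq2 q (card_minimal_dominating LU Lq nopat qU domK Kmin).
exists s, t; have [_ /eqP<-] := andP domK.
by rewrite qK -setUA !dominatedU1 -[[set t]]setU0 dominatedU1 dominated0.
Qed.

End Tournament.

(** * Local ratio *)

Definition set_weight (V : finType) (u : V -> nat) (X : {set V}) : nat :=
  \sum_(x in X) u x.

Lemma set_weightC (V : finType) (u : V -> nat) (X : {set V}) :
  set_weight u setT = set_weight u X + set_weight u (~: X).
Proof. by rewrite /set_weight (big_setID X) /= setTI setTD. Qed.

Lemma set_weight_setI_support (V : finType) (u : V -> nat) (X : {set V}) :
  set_weight u (X :&: [set x | 0 < u x]) = set_weight u X.
Proof.
rewrite /set_weight [RHS](big_setID [set x | 0 < u x]) /=.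
rewrite [X in _ = _ + X]big1 ?addn0 // => x.
by rewrite !inE -eqn0Ngt => /andP[/eqP].
Qed.

Lemma local_ratio (V : finType) (u u' : V -> nat) (H S S' : {set V}) m a b :
  (forall x, u x = u' x + (x \in H) * m) -> #|S :&: H| <= b -> a <= #|S' :&: H| ->
  a * set_weight u S + b * set_weight u' S' <=
  b * set_weight u S' + a * set_weight u' S.
Proof.
move=> uE leSb leaS'.
have set_weightE X : set_weight u X = set_weight u' X + #|X :&: H| * m.
  rewrite /set_weight (eq_bigr _ (fun x _ => uE x)) big_split /= -big_distrl /=.
  rewrite -sum1_card big_mkcond [X in _ = _ + X * _]big_mkcond /=.
  congr (_ + _ * m); rewrite big_mkcond; apply: eq_bigr => x _; rewrite inE.
  by case: (x \in X); case: (x \in H).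
have := leq_mul (leq_mul leSb leaS') (leqnn m).
by rewrite !set_weightE; nia.
Qed.

Definition min_weight (T : Type) (u : T -> nat) (t : septuple T) : nat :=
  foldr minn (u t.1) (map u (septuple_seq t)).

Lemma min_weight_leq (T : eqType) (u : T -> nat) t x :
  x \in septuple_seq t -> min_weight u t <= u x.
Proof.
rewrite /min_weight; move: (u t.1) => n; elim: (septuple_seq t) => //= y s IH.
by rewrite inE geq_min => /orP[/eqP->|/IH->]; rewrite ?leqnn ?orbT.
Qed.

Lemma min_weight_attained (T : eqType) (u : T -> nat) t :
  exists2 x, x \in septuple_seq t & u x = min_weight u t.
Proof.
have : min_weight u t \in u t.1 :: map u (septuple_seq t).
  rewrite /min_weight; move: (u t.1) => n; elim: (septuple_seq t) => [|y s IH] /=.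
    by rewrite mem_head.
  rewrite /minn; case: ifP => _; first by rewrite !inE eqxx orbT.
  by move: IH; rewrite !inE => /orP[->//|->]; rewrite !orbT.
rewrite inE => /orP[/eqP->|/mapP[x xt ->]]; last by exists x.
by exists t.1; rewrite // mem_head.
Qed.

Definition reduce (T : eqType) (A : rel T) (u : T -> nat) (t : septuple T) (x : T) :
    nat :=
  if pattern A t && (x \in septuple_seq t) then u x - min_weight u t else u x.

Lemma reduce_leq (T : eqType) (A : rel T) (u : T -> nat) t x : reduce A u t x <= u x.
Proof. by rewrite /reduce; case: ifP => _ //; apply: leq_subr. Qed.

Lemma reduce_eq0 (T : eqType) (A : rel T) (u : T -> nat) t : pattern A t ->
  exists2 x, x \in septuple_seq t & reduce A u t x = 0.
Proof.
move=> pat; have [x xt ux] := min_weight_attained u t.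
by exists x => //; rewrite /reduce pat xt ux subnn.
Qed.

Section Reduction.
Variables (V : finType) (A : rel V).
Hypothesis tour : tournament A.

Lemma reduce_local_ratio (u : V -> nat) t (S S' : {set V}) :
  feedback_vertex_set A S' ->
  3 * set_weight u S + 7 * set_weight (reduce A u t) S' <=
  7 * set_weight u S' + 3 * set_weight (reduce A u t) S.
Proof.
move=> fvsS'; rewrite /reduce.
have [pat|_] /= := boolP (pattern A t); last by rewrite addnC.
pose H := [set x in septuple_seq t].
have card_capH (X : {set V}) : #|X :&: H| = count (fun x => x \in X) (septuple_seq t).
  rewrite -size_filter -(card_uniqP (filter_uniq _ (pattern_uniq tour pat))).
  by apply: eq_card => x; rewrite inE inE mem_filter.
apply: (local_ratio (H := H) (m := min_weight u t)) => [x||].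
- rewrite in_set; case: ifP => [xt|_] /=; last by rewrite mul0n addn0.
  by rewrite mul1n subnK // min_weight_leq.
- by rewrite card_capH count_size.
- by rewrite card_capH (pattern_hits tour).
Qed.

Lemma foldl_reduce_leq u s x : foldl (reduce A) u s x <= u x.
Proof. by elim: s u => //= t s IH u; apply: leq_trans (IH _) (reduce_leq _ _ _ _). Qed.

Lemma foldl_reduce_local_ratio u s (S S' : {set V}) : feedback_vertex_set A S' ->
  3 * set_weight u S + 7 * set_weight (foldl (reduce A) u s) S' <=
  7 * set_weight u S' + 3 * set_weight (foldl (reduce A) u s) S.
Proof.
move=> fvsS'; elim: s u => [|t s IH] u; first by rewrite addnC.
rewrite -[foldl _ u _]/(foldl (reduce A) (reduce A u t) s).
by have := IH (reduce A u t); have := reduce_local_ratio u t S fvsS'; lia.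
Qed.

Lemma foldl_reduce_pattern_free u s : (forall t, t \in s) ->
  pattern_free A [set x | 0 < foldl (reduce A) u s x].
Proof.
move=> all_s t tU; apply/negP => pat.
have [x xt] : exists2 x, x \in septuple_seq t & foldl (reduce A) u s x = 0.
  have := all_s t; elim: s u {all_s tU} => //= t' s IH u; rewrite inE.
  case/orP=> [/eqP<-|]; last exact: IH.
  have [x xt ux] := reduce_eq0 u pat; exists x => //; apply/eqP.
  by rewrite -leqn0 -ux foldl_reduce_leq.
by have := tU x xt; rewrite inE lt0n => /eqP.
Qed.

End Reduction.

(** * Dynamic programming on pattern-free sets *)

Section Dynamic.
Variables (V : finType) (A : rel V).
Hypothesis tour : tournament A.
Variables (u : V -> nat) (U : {set V}) (ts : seq (V * (V * V))).

Definition chain_range (t : V * (V * V)) : {set V} :=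
  out_nbr A t.1 :&: (out_nbr A t.2.1 :&: (out_nbr A t.2.2 :&: U)).

Definition best_chain (X : V * (V * V) -> {set V}) (R : {set V}) : {set V} :=
  heaviest (set_weight u) set0
    [seq t.1 |: X t | t <- ts & (t.1 \in R) && (chain_range t \subset R)].

Definition chains (n : nat) : V * (V * V) -> {set V} :=
  iter n (fun X t => best_chain X (chain_range t)) (fun=> set0).

Definition heaviest_chain : {set V} := best_chain (chains #|V|) U.

Definition sound (X : V * (V * V) -> {set V}) : Prop :=
  forall t, X t \subset chain_range t /\ transitive_set A (X t).

Lemma best_chain_sound X R : sound X ->
  best_chain X R \subset R /\ transitive_set A (best_chain X R).
Proof.
move=> soundX; apply: (heaviest_ind
  (P := fun C : {set V} => C \subset R /\ transitive_set A C)) => [|_ /mapP[t + ->]].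
  by rewrite sub0set transitive_set0.
rewrite mem_filter => /andP[/andP[tR rangeR] _]; have [Xt trX] := soundX t; split.
  by rewrite subUset sub1set tR (subset_trans Xt).
by apply: transitive_setU1 => //; apply: subset_trans Xt (subsetIl _ _).
Qed.

Lemma chains_sound n : sound (chains n).
Proof.
elim: n => [|n IH] t /=; first by rewrite sub0set transitive_set0.
exact: best_chain_sound.
Qed.

Lemma best_chain_max X (R : {set V}) t : t \in ts ->
  t.1 \in R -> chain_range t \subset R ->
  set_weight u (t.1 |: X t) <= set_weight u (best_chain X R).
Proof.
move=> t_ts tR rangeR; apply: heaviest_max; rewrite inE; apply/orP; right.
by apply/mapP; exists t; rewrite // mem_filter tR rangeR.
Qed.

Hypothesis ts_full : forall t, t \in ts.
Hypothesis nopat : pattern_free A U.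

(** Enlarging [L] by all vertices of [U] that dominate [q] and [Y] keeps [Y]
    in the dominated set and makes three vertices sufficient to describe it. *)
Lemma chain_range_below (Y L : {set V}) q : q \in Y -> Y :\ q \subset out_nbr A q ->
  Y \subset dominated A U L -> L \subset U ->
  exists t (L' : {set V}), [/\ t.1 = q, L' \subset U,
    chain_range t = dominated A U L', Y :\ q \subset dominated A U L' &
    dominated A U L' \subset dominated A U L].
Proof.
move=> qY Yq YL LU; have /dominatedP[qU Lq] := subsetP YL _ qY.
pose L' := [set x in U | A x q && (Y :\ q \subset out_nbr A x)].
have L'U : L' \subset U by apply/subsetP => x; rewrite inE => /andP[].
have L'q : {in L', forall x, A x q} by move=> x; rewrite inE => /and3P[].
have [s [t domE]] := dominated_by_three tour nopat qU L'U L'q.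
exists (q, (s, t)), (q |: L'); split=> //.
- by rewrite subUset sub1set qU.
- apply/subsetP => z zY'; have /setD1P[_ zY] := zY'.
  have /dominatedP[zU _] := subsetP YL _ zY.
  apply/dominatedP; split=> // x; rewrite in_setU1 => /orP[/eqP->|].
    by have := subsetP Yq _ zY'; rewrite inE.
  by rewrite inE => /and3P[_ _ /subsetP/(_ z zY')]; rewrite inE.
- apply/dominatedS/subsetP => x xL; rewrite !inE (subsetP LU _ xL) Lq //=.
  apply/orP; right; apply/subsetP => z /setD1P[_ zY]; rewrite inE.
  by case/dominatedP: (subsetP YL _ zY) => _ /(_ _ xL).
Qed.

Lemma best_chain_complete n (Y L : {set V}) : #|Y| <= n -> transitive_set A Y ->
  Y \subset dominated A U L -> L \subset U ->
  set_weight u Y <= set_weight u (best_chain (chains n) (dominated A U L)).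
Proof.
elim: n Y L => [|n IH] Y L.
  by rewrite leqn0 cards_eq0 => /eqP->; rewrite /set_weight big_set0.
have [->|Y_neq0] := eqVneq Y set0; first by rewrite /set_weight big_set0.
move=> leYn trY YL LU; have [q qY Yq] := transitive_set_source tour trY Y_neq0.
have [t [L' [tq L'U rangeE YL' L'L]]] := chain_range_below qY Yq YL LU.
have leY' : set_weight u (Y :\ q) <= set_weight u (chains n.+1 t).
  rewrite /= rangeE; apply: IH => //; last exact: transitive_setS (subD1set _ _) trY.
  by move: leYn; rewrite (cardsD1 q) qY.
have q_chain : q \notin chains n.+1 t.
  have [/subsetP chain_range_t _] := chains_sound n.+1 t.
  by apply/negP => /chain_range_t; rewrite !inE tq (arcxx tour).
apply: leq_trans (best_chain_max (chains n.+1) (ts_full t) _ _); rewrite ?tq ?rangeE //.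
  rewrite /set_weight [X in _ <= X]big_setU1 //.
  by rewrite [X in X <= _](big_setD1 q qY) leq_add2l.
exact: subsetP YL _ qY.
Qed.

Lemma heaviest_chain_max (Y : {set V}) : transitive_set A Y -> Y \subset U ->
  set_weight u Y <= set_weight u heaviest_chain.
Proof.
move=> trY YU; rewrite /heaviest_chain -[X in best_chain _ X](dominated0 A).
by apply: best_chain_complete; rewrite ?dominated0 ?sub0set ?max_card.
Qed.

Lemma heaviest_chain_transitive : transitive_set A heaviest_chain.
Proof. by have [] := best_chain_sound U (chains_sound #|V|). Qed.

End Dynamic.

Definition approx_fvs (V : finType) (A : rel V) (u : V -> nat)
    (ss : seq (septuple V)) (ts : seq (V * (V * V))) : {set V} :=
  let u' := foldl (reduce A) u ss in
  ~: heaviest_chain A u' [set x | 0 < u' x] ts.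

Section Approximation.
Variables (V : finType) (A : rel V) (u : V -> nat).
Variables (ss : seq (septuple V)) (ts : seq (V * (V * V))).
Hypothesis tour : tournament A.

Lemma approx_fvs_feedback : feedback_vertex_set A (approx_fvs A u ss ts).
Proof. by apply/(fvsP tour); rewrite setCK; apply: heaviest_chain_transitive. Qed.

Lemma approx_fvs_ratio (S : {set V}) :
  (forall t, t \in ss) -> (forall t, t \in ts) -> feedback_vertex_set A S ->
  3 * set_weight u (approx_fvs A u ss ts) <= 7 * set_weight u S.
Proof.
move=> ss_full ts_full fvsS; rewrite /approx_fvs /=.
have := foldl_reduce_local_ratio tour u ss _ fvsS.
have := foldl_reduce_pattern_free (A := A) (u := u) ss_full.
set u' := foldl _ u ss; set U := [set x | _].
set C := heaviest_chain _ _ _ _ => nopat ratio.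
suff: set_weight u' (~: C) <= set_weight u' S by have := ratio (~: C); lia.
have trS : transitive_set A (~: S :&: U).
  by apply: transitive_setS (subsetIl _ _) _; apply/(fvsP tour).
have := heaviest_chain_max tour u' ts_full nopat trS (subsetIr _ _).
rewrite set_weight_setI_support -/C.
by have := set_weightC u' S; rewrite (set_weightC u' C); lia.
Qed.

End Approximation.

(** * The algorithm *)

Definition triples (T : Type) (s : seq T) : seq (T * (T * T)) :=
  [seq (x, t) | x <- s, t <- [seq (y, z) | y <- s, z <- s]].

Definition septuples (T : Type) (s : seq T) : seq (septuple T) :=
  let cons_all (S : Type) (r : seq S) := [seq (x, t) | x <- s, t <- r] in
  cons_all _ (cons_all _ (cons_all _ (cons_all _ (triples s)))).

Definition scaled_weights (w : seq (nat * nat)) : seq nat :=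
  [seq (nth (0, 0) w i).1 *
       prodn [seq if j == i then 1 else (nth (0, 0) w j).2 | j : nat <- iota 0 (size w)]
  | i <- iota 0 (size w)].

Definition matrix_arc (M : seq (seq bool)) (i j : nat) : bool :=
  nth false (nth [::] M i) j.

Definition reduce_seq (M : seq (seq bool)) (W : seq nat) (t : septuple nat) : seq nat :=
  [seq reduce (matrix_arc M) (nth 0 W) t i | i <- iota 0 (size W)].

Definition reduced_weights (M : seq (seq bool)) (W : seq nat) : seq nat :=
  foldl (reduce_seq M) W (septuples (iota 0 (size M))).

(* The triple [(q, (s, t))] matters only through [q] and its range. *)
Notation state := (nat * seq bool)%type.

Definition states (M : seq (seq bool)) (U : seq bool) : seq state :=
  [seq (t.1, [seq [&& matrix_arc M t.1 i, matrix_arc M t.2.1 i,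
                      matrix_arc M t.2.2 i & nth false U i]
             | i <- iota 0 (size M)])
  | t <- triples (iota 0 (size M))].

Definition empty_mask (W : seq nat) : seq bool := [seq false | _ <- W].

Definition add_mask (W : seq nat) (q : nat) (X : seq bool) : seq bool :=
  [seq (i == q) || nth false X i | i : nat <- iota 0 (size W)].

Definition subset_mask (X Y : seq bool) : bool :=
  all (fun i : nat => nth false X i ==> nth false Y i) (iota 0 (size X)).

Definition weight_mask (W : seq nat) (X : seq bool) : nat :=
  sumn [seq if nth false X i then nth 0 W i else 0 | i <- iota 0 (size W)].

Definition best_mask (W : seq nat) (table : seq (state * seq bool)) (R : seq bool) :
    seq bool :=
  heaviest (weight_mask W) (empty_mask W)
    [seq add_mask W e.1.1 e.2
    | e <- table & nth false R e.1.1 && subset_mask e.1.2 R].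

(* [W] also serves as the counter of the rounds, one per vertex. *)
Definition chain_masks (W : seq nat) (ss : seq state) : seq (seq bool) :=
  foldl (fun Xs _ => [seq best_mask W (zip ss Xs) s.2 | s <- ss])
    [seq empty_mask W | _ <- ss] W.

Definition fvs_mask (I : seq (seq bool) * seq (nat * nat)) : seq bool :=
  let W := reduced_weights I.1 (scaled_weights I.2) in
  let U := [seq 0 < n | n <- W] in
  let ss := states I.1 U in
  [seq ~~ b | b <- best_mask W (zip ss (chain_masks W ss)) U].

Lemma polytime_triples (X : encType) (s : X -> seq nat) :
  polytime s -> polytime (fun x => triples (s x)).
Proof.
move=> ps; apply: (polytime_comp ps (g := @triples nat)).
by rewrite /triples; polytime.
Qed.
#[local] Hint Resolve polytime_triples : polytime.

Lemma polytime_septuples (X : encType) (s : X -> seq nat) :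
  polytime s -> polytime (fun x => septuples (s x)).
Proof.
move=> ps; apply: (polytime_comp ps (g := @septuples nat)).
by rewrite /septuples; polytime.
Qed.
#[local] Hint Resolve polytime_septuples : polytime.

Lemma polytime_scaled_weights (X : encType) (w : X -> seq (nat * nat)) :
  polytime w -> polytime (fun x => scaled_weights (w x)).
Proof.
move=> pw; apply: (polytime_comp pw (g := scaled_weights)).
by rewrite /scaled_weights; polytime.
Qed.

Lemma polytime_matrix_arc (X : encType) (M : X -> seq (seq bool)) (i j : X -> nat) :
  polytime M -> polytime i -> polytime j ->
  polytime (fun x => matrix_arc (M x) (i x) (j x)).
Proof. by move=> pM pi pj; rewrite /matrix_arc; polytime. Qed.
#[local] Hint Resolve polytime_scaled_weights polytime_matrix_arc : polytime.

Lemma polytime_reduce_seq (X : encType) (M : X -> seq (seq bool)) (W : X -> seq nat)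
    (t : X -> septuple nat) :
  polytime M -> polytime W -> polytime t ->
  polytime (fun x => reduce_seq (M x) (W x) (t x)).
Proof.
apply: polytime_comp3.
rewrite /reduce_seq /reduce /min_weight /pattern /septuple_seq /=.
by polytime.
Qed.
#[local] Hint Resolve polytime_reduce_seq : polytime.

Lemma reduce_seq_leq M W t : size (reduce_seq M W t) = size W /\
  forall i, nth 0 (reduce_seq M W t) i <= nth 0 W i.
Proof.
rewrite size_map size_iota; split=> // i.
have [lt_iW|le_Wi] := ltnP i (size W).
  by rewrite (nth_map 0) ?size_iota // nth_iota // reduce_leq.
by rewrite nth_default // size_map size_iota.
Qed.

Lemma foldl_reduce_seq_leq M W ts : size (foldl (reduce_seq M) W ts) = size W /\
  forall i, nth 0 (foldl (reduce_seq M) W ts) i <= nth 0 W i.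
Proof.
elim/last_ind: ts => // ts t [sizeE leW]; rewrite foldl_rcons.
have [-> le_step] := reduce_seq_leq M (foldl (reduce_seq M) W ts) t.
by split=> // i; apply: leq_trans (le_step i) (leW i).
Qed.

Lemma code_size_nth_leq (W W' : seq nat) : size W' = size W ->
  (forall i, nth 0 W' i <= nth 0 W i) -> code_size W' <= 5 * code_size W.
Proof.
elim: W W' => [|n W IH] [|n' W'] // [sizeE] leW; rewrite !code_size_cons.
have := IH W' sizeE (fun i => leW i.+1).
by have := leq_code_size_nat (leW 0); have := code_size_gt0 n; rewrite /=; lia.
Qed.

Lemma polytime_reduced_weights (X : encType) (M : X -> seq (seq bool))
    (W : X -> seq nat) :
  polytime M -> polytime W -> polytime (fun x => reduced_weights (M x) (W x)).
Proof.
apply: polytime_comp2.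
apply: (polytime_foldl (p := fun n => 5 * n)); polytime.
move=> z ts; have [sizeE leW] := foldl_reduce_seq_leq z.1 z.2 ts.
by apply: leq_trans (code_size_nth_leq sizeE leW) _; lia.
Qed.

Lemma polytime_states (X : encType) (M : X -> seq (seq bool)) (U : X -> seq bool) :
  polytime M -> polytime U -> polytime (fun x => states (M x) (U x)).
Proof. by apply: polytime_comp2; rewrite /states; polytime. Qed.
#[local] Hint Resolve polytime_reduced_weights polytime_states : polytime.

Lemma polytime_empty_mask (X : encType) (W : X -> seq nat) :
  polytime W -> polytime (fun x => empty_mask (W x)).
Proof. by move=> pW; rewrite /empty_mask; polytime. Qed.

Lemma polytime_add_mask (X : encType) (W : X -> seq nat) (q : X -> nat)
    (C : X -> seq bool) :
  polytime W -> polytime q -> polytime C ->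
  polytime (fun x => add_mask (W x) (q x) (C x)).
Proof. by apply: polytime_comp3; rewrite /add_mask; polytime. Qed.

Lemma polytime_subset_mask (X : encType) (C D : X -> seq bool) :
  polytime C -> polytime D -> polytime (fun x => subset_mask (C x) (D x)).
Proof. by apply: polytime_comp2; rewrite /subset_mask; polytime. Qed.

Lemma polytime_weight_mask (X : encType) (W : X -> seq nat) (C : X -> seq bool) :
  polytime W -> polytime C -> polytime (fun x => weight_mask (W x) (C x)).
Proof. by apply: polytime_comp2; rewrite /weight_mask; polytime. Qed.
#[local] Hint Resolve polytime_empty_mask polytime_add_mask polytime_subset_mask
  polytime_weight_mask : polytime.

Lemma polytime_best_mask (X : encType) (W : X -> seq nat)
    (table : X -> seq (state * seq bool)) (R : X -> seq bool) :
  polytime W -> polytime table -> polytime R ->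
  polytime (fun x => best_mask (W x) (table x) (R x)).
Proof. by apply: polytime_comp3; rewrite /best_mask; polytime. Qed.
#[local] Hint Resolve polytime_best_mask : polytime.

Lemma size_best_mask W table R : size (best_mask W table R) = size W.
Proof.
apply: (heaviest_ind (P := fun C => size C = size W)) => [|_ /mapP[e _ ->]].
  by rewrite size_map.
by rewrite size_map size_iota.
Qed.

Lemma code_size_best_mask W table R :
  code_size (best_mask W table R) <= 3 * code_size (empty_mask W).
Proof.
have /andP[_] := code_size_bits_bounds (best_mask W table R); rewrite size_best_mask.
by have /andP[+ _] := code_size_bits_bounds (empty_mask W); rewrite size_map; lia.
Qed.

Lemma code_size_map_leq (T : Type) (X Y : encType) (f : T -> X) (g : T -> Y) c s :
  (forall x, code_size (f x) <= c.+1 * code_size (g x)) ->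
  code_size (map f s) <= c.+1 * code_size (map g s).
Proof.
move=> le_fg; elim: s => [|x s IH] /=; first by rewrite leq_pmull.
by have := le_fg x; rewrite !code_size_cons; lia.
Qed.

Lemma polytime_chain_masks (X : encType) (W : X -> seq nat) (ss : X -> seq state) :
  polytime W -> polytime ss -> polytime (fun x => chain_masks (W x) (ss x)).
Proof.
apply: polytime_comp2; apply: (polytime_foldl (p := fun n => 3 * n)); polytime.
move=> z r; set Xs0 := map _ z.2.
apply: (@leq_trans (3 * code_size Xs0)); last by lia.
elim/last_ind: r => [|r n _]; first by rewrite leq_pmull.
by rewrite foldl_rcons; apply: code_size_map_leq => s; apply: code_size_best_mask.
Qed.
#[local] Hint Resolve polytime_chain_masks : polytime.

Lemma polytime_fvs_mask : polytime fvs_mask.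
Proof. by rewrite /fvs_mask; polytime. Qed.

(** * Correctness of the algorithm *)

Lemma allpairs_map_pair (S S' T T' : Type) (f : S -> S') (g : T -> T') s t :
  [seq (x, y) | x <- map f s, y <- map g t] =
  [seq (f p.1, g p.2) | p <- [seq (x, y) | x <- s, y <- t]].
Proof. by rewrite map_allpairs allpairs_mapl allpairs_mapr. Qed.

Definition septuple_map (S T : Type) (f : S -> T) (t : septuple S) : septuple T :=
  (f t.1, (f t.2.1, (f t.2.2.1, (f t.2.2.2.1, (f t.2.2.2.2.1, (f t.2.2.2.2.2.1,
    f t.2.2.2.2.2.2)))))).

Definition triple_map (S T : Type) (f : S -> T) (t : S * (S * S)) : T * (T * T) :=
  (f t.1, (f t.2.1, f t.2.2)).

Lemma triples_map (S T : Type) (f : S -> T) s :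
  triples (map f s) = map (triple_map f) (triples s).
Proof. by rewrite /triples !allpairs_map_pair. Qed.

Lemma septuples_map (S T : Type) (f : S -> T) s :
  septuples (map f s) = map (septuple_map f) (septuples s).
Proof. by rewrite /septuples triples_map !allpairs_map_pair. Qed.

Lemma mem_triples_enum (V : finType) (t : V * (V * V)) : t \in triples (enum V).
Proof. by case: t => x [y z]; rewrite !allpairs_f ?mem_enum. Qed.

Lemma mem_septuples_enum (V : finType) (t : septuple V) : t \in septuples (enum V).
Proof.
case: t => x1 [x2 [x3 [x4 t]]].
by rewrite /septuples !allpairs_f ?mem_triples_enum ?mem_enum.
Qed.

Section Refinement.
Variables (V : finType) (A : rel V).

Definition rank (x : V) : nat := index x (enum V).

Definition tabulate (T : Type) (f : V -> T) : seq T := [seq f x | x <- enum V].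

Definition bitmask (C : {set V}) : seq bool := tabulate (fun x => x \in C).

Definition adjacency : seq (seq bool) := tabulate (fun x => tabulate (A x)).

Lemma rank_inj : injective rank.
Proof. by move=> x y; apply: (seq.index_inj x); rewrite mem_enum. Qed.

Lemma size_tabulate (T : Type) (f : V -> T) : size (tabulate f) = #|V|.
Proof. by rewrite size_map cardE. Qed.

Lemma nth_tabulate (T : Type) d (f : V -> T) x : nth d (tabulate f) (rank x) = f x.
Proof. by rewrite (nth_map x) ?index_mem ?nth_index ?mem_enum. Qed.

Lemma eq_tabulate (T : Type) (f g : V -> T) : f =1 g -> tabulate f = tabulate g.
Proof. by move=> fg; apply: eq_map. Qed.

Lemma tabulate_rank : iota 0 #|V| = tabulate rank.
Proof.
apply: (@eq_from_nth _ 0); first by rewrite size_iota size_tabulate.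
rewrite size_iota => i lt_i.
have x0 : V by move: lt_i; case: (enum V) (cardE V) => [->|].
by rewrite nth_iota // (nth_map x0) /rank ?index_uniq ?enum_uniq -?cardE.
Qed.

Lemma map_iota_tabulate (T : Type) (F : nat -> T) :
  [seq F i | i <- iota 0 #|V|] = tabulate (fun x => F (rank x)).
Proof. by rewrite tabulate_rank -map_comp. Qed.

Lemma size_adjacency : size adjacency = #|V|.
Proof. exact: size_tabulate. Qed.

Lemma matrix_arcE x y : matrix_arc adjacency (rank x) (rank y) = A x y.
Proof. by rewrite /matrix_arc !nth_tabulate. Qed.

Definition clear_denominators (q : V -> nat * nat) (x : V) : nat :=
  (q x).1 * \prod_(y | y != x) (q y).2.

Lemma scaled_weights_tabulate (q : V -> nat * nat) :
  scaled_weights (tabulate q) = tabulate (clear_denominators q).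
Proof.
rewrite /scaled_weights size_tabulate map_iota_tabulate; apply: eq_tabulate => x.
rewrite nth_tabulate map_iota_tabulate /prodn foldrE big_map; congr (_ * _).
rewrite big_enum [RHS]big_mkcond; apply: eq_bigr => y _.
by rewrite nth_tabulate (inj_eq rank_inj); case: eqVneq.
Qed.

Lemma reduce_seq_tabulate (u : V -> nat) t :
  reduce_seq adjacency (tabulate u) (septuple_map rank t) = tabulate (reduce A u t).
Proof.
rewrite /reduce_seq size_tabulate map_iota_tabulate; apply: eq_tabulate => x.
rewrite /reduce -[septuple_seq (septuple_map _ _)]/(map rank (septuple_seq t)).
rewrite (mem_map rank_inj) nth_tabulate.
have -> : pattern (matrix_arc adjacency) (septuple_map rank t) = pattern A t.
  by rewrite /pattern /= !matrix_arcE.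
by rewrite /min_weight /= !nth_tabulate.
Qed.

Lemma reduced_weights_tabulate (u : V -> nat) :
  reduced_weights adjacency (tabulate u) =
  tabulate (foldl (reduce A) u (septuples (enum V))).
Proof.
rewrite /reduced_weights size_adjacency tabulate_rank septuples_map.
by elim: (septuples _) u => //= t s IH u; rewrite reduce_seq_tabulate IH.
Qed.

Lemma add_mask_tabulate (u : V -> nat) q (C : {set V}) :
  add_mask (tabulate u) (rank q) (bitmask C) = bitmask (q |: C).
Proof.
rewrite /add_mask size_tabulate map_iota_tabulate; apply: eq_tabulate => x.
by rewrite nth_tabulate (inj_eq rank_inj) in_setU1.
Qed.

Lemma subset_maskE (C D : {set V}) :
  subset_mask (bitmask C) (bitmask D) = (C \subset D).
Proof.
rewrite /subset_mask size_tabulate tabulate_rank all_map.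
apply/allP/subsetP => [CD x xC|CD x _].
  by have := CD x; rewrite mem_enum /= !nth_tabulate xC => /(_ isT).
by rewrite /= !nth_tabulate; apply/implyP/CD.
Qed.

Lemma weight_mask_tabulate (u : V -> nat) (C : {set V}) :
  weight_mask (tabulate u) (bitmask C) = set_weight u C.
Proof.
rewrite /weight_mask size_tabulate map_iota_tabulate sumnE big_map big_enum.
by rewrite /set_weight [RHS]big_mkcond; apply: eq_bigr => x _; rewrite !nth_tabulate.
Qed.

Lemma empty_mask_tabulate (u : V -> nat) : empty_mask (tabulate u) = bitmask set0.
Proof. by rewrite /empty_mask -map_comp; apply: eq_tabulate => x; rewrite inE. Qed.

Section Chains.
Variables (u : V -> nat) (U : {set V}).
Notation ts := (triples (enum V)).
Notation mask_states := [seq (rank t.1, bitmask (chain_range A U t)) | t <- ts].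

Lemma states_adjacency : states adjacency (bitmask U) = mask_states.
Proof.
rewrite /states size_adjacency tabulate_rank triples_map -map_comp.
apply: eq_map => t /=; congr (_, _); rewrite -tabulate_rank map_iota_tabulate.
by apply: eq_tabulate => x; rewrite !matrix_arcE nth_tabulate !inE.
Qed.

Lemma best_mask_states X (R : {set V}) :
  best_mask (tabulate u) (zip mask_states [seq bitmask (X t) | t <- ts]) (bitmask R) =
  bitmask (best_chain A u U ts X R).
Proof.
rewrite /best_mask empty_mask_tabulate zip_map filter_map -map_comp.
under eq_filter do rewrite /= nth_tabulate subset_maskE.
under eq_map do rewrite /= add_mask_tabulate.
rewrite (map_comp bitmask); apply: heaviest_map => C.
exact: weight_mask_tabulate.
Qed.

Lemma chain_masks_states :
  chain_masks (tabulate u) mask_states =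
  [seq bitmask (chains A u U ts #|V| t) | t <- ts].
Proof.
rewrite /chain_masks -map_comp empty_mask_tabulate -(size_tabulate u).
elim/last_ind: {2 3}(tabulate u) => // r n IH.
rewrite foldl_rcons IH size_rcons -map_comp; apply: eq_map => t.
by rewrite /= best_mask_states.
Qed.

End Chains.

Lemma fvs_mask_tabulate (q : V -> nat * nat) :
  fvs_mask (adjacency, tabulate q) = bitmask
    (approx_fvs A (clear_denominators q) (septuples (enum V)) (triples (enum V))).
Proof.
rewrite /fvs_mask /= scaled_weights_tabulate reduced_weights_tabulate -map_comp.
set u' := foldl _ _ _; set U := [set x | 0 < u' x].
have -> : [seq 0 < u' x | x <- enum V] = bitmask U.
  by apply: eq_tabulate => x; rewrite inE.
rewrite states_adjacency chain_masks_states best_mask_states -map_comp.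
by apply: eq_tabulate => x; rewrite /= in_setC.
Qed.

End Refinement.

Lemma enc_seqE (S : Type) (X : encType) (f : S -> tree) (g : S -> X) s :
  (forall x, f x = code (g x)) -> enc_seq f s = code (map g s).
Proof. by move=> fg; elim: s => //= x s ->; rewrite fg. Qed.

Lemma enc_setE (V : finType) (S : {set V}) : enc_set S = code (bitmask S).
Proof. exact: enc_seqE. Qed.

Definition fraction (q : rat) : nat * nat := (`|numq q|%N, `|denq q|%N).

Lemma enc_instanceE (V : finType) (A : rel V) (w : V -> rat) :
  enc_instance A w =
  code (adjacency A, tabulate (fun x => fraction (w x))).
Proof. by congr Cons; apply: enc_seqE => x //; apply: enc_seqE. Qed.

Lemma polytime_runs (X Y : encType) (f : X -> Y) : polytime f ->
  exists P a k, forall x, exists2 t, runs P (code x) t (code (f x)) &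
    t <= a * tree_size (code x) ^ k + a.
Proof.
move=> [P [N [p [gp _ Pf]]]]; have [a [k le_p]] := polygrowth_leq_monomial gp.
exists P, a, k => x.
have [t [s [Ps le_t [s0 _]]]] := Pf x (upd (fun=> Nil) 0 (code x)) erefl.
exists t; first by exists s.
exact: leq_trans le_t (le_p _ (code_size_gt0 x)).
Qed.

Lemma min_fvs_weight_exists (V : finType) (A : rel V) (w : V -> rat) :
  tournament A -> exists2 S, feedback_vertex_set A S & min_fvs_weight A w (weight w S).
Proof.
move=> tour.
have trT : transitive_set A (~: [set: V]) by rewrite setCT transitive_set0.
case: (Order.TotalTheory.arg_minP
  (P := fun S : {set V} => transitive_set A (~: S)) (weight w) trT).
move=> S /(fvsP tour) fvsS Smin; exists S => //.
by split=> [|S' /(fvsP tour)]; [exists S | apply: Smin].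
Qed.

Import GRing.Theory Num.Theory Order.TTheory.

Section ClearDenominators.
Local Open Scope ring_scope.
Variables (V : finType) (w : V -> rat).
Hypothesis w_ge0 : forall v, 0 <= w v.
Let u : V -> nat := clear_denominators (fun x => fraction (w x)).

Lemma set_weight_clear_denominators (S : {set V}) :
  (set_weight u S)%:R = weight w S * (\prod_y `|denq (w y)|)%N%:R.
Proof.
rewrite /set_weight /weight natr_sum mulr_suml; apply: eq_bigr => x _.
rewrite (bigD1 x) //= /u /clear_denominators !natrM mulrA; congr (_ * _).
by rewrite !natr_absz !ger0_norm ?denq_ge0 ?numq_ge0 // numqE.
Qed.

Lemma clear_denominators_ratio (S S' : {set V}) a b :
  (a * set_weight u S <= b * set_weight u S')%N ->
  a%:R * weight w S <= b%:R * weight w S'.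
Proof.
rewrite -(ler_nat rat) !natrM !set_weight_clear_denominators !mulrA.
by rewrite ler_pM2r // ltr0n prodn_gt0 // => y; rewrite absz_gt0 denq_neq0.
Qed.

End ClearDenominators.

Theorem theorem1 :
  exists (P : cmd) (a k : nat),
    forall (V : finType) (A : rel V) (w : V -> rat),
      tournament A -> (forall v : V, 0 <= w v)%R ->
      exists (t : nat) (S : {set V}) (opt : rat),
        [/\ runs P (enc_instance A w) t (enc_set S),
            t <= a * tree_size (enc_instance A w) ^ k + a,
            feedback_vertex_set A S,
            min_fvs_weight A w opt
          & (weight w S <= 7 / 3 * opt)%R].
Proof.
have [P [a [k runsP]]] := polytime_runs polytime_fvs_mask.
exists P, a, k => V A w tour w_ge0.
pose q x := fraction (w x).
pose S := approx_fvs A (clear_denominators q) (septuples (enum V)) (triples (enum V)).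
have [S' fvsS' optS'] := min_fvs_weight_exists w tour.
have [t runs_t le_t] := runsP (adjacency A, tabulate q).
exists t, S, (weight w S'); split=> //; rewrite ?enc_instanceE //.
- by rewrite enc_setE -fvs_mask_tabulate.
- exact: approx_fvs_feedback.
have ratio := approx_fvs_ratio (clear_denominators q) tour
  (@mem_septuples_enum V) (@mem_triples_enum V) fvsS'.
have := clear_denominators_ratio w_ge0 ratio.
by rewrite mulrAC ler_pdivlMr // mulrC.
Qed.
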